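(* Let $r\ge3$, and let $AD$ be the symmetric $r\times r$ matrix with entries $(AD)_{11}=2$, $(AD)_{1r}=(AD)_{r1}=1$, $(AD)_{1j}=(AD)_{j1}=0$ for $2\le j\le r-1$, $(AD)_{ij}=4(\min(i,j)-1)$ for $2\le i,j\le r-1$, $(AD)_{ir}=(AD)_{ri}=2(i-1)$ for $2\le i\le r-1$, $(AD)_{rr}=r-1$. Let $\boldsymbol b_{r+1}=(0,\ldots,0,1)^T$ and $\widetilde{\boldsymbol b}_{r+1}=(1,2,4,\ldots,2(r-2),r)^T$ (first entry $1$, $i$-th entry $2(i-1)$ for $2\le i\le r-1$, last entry $r$). Then $$\sum_{\boldsymbol n=(n_1,\ldots,n_r)^T\in\mathbb{N}^r}\frac{q^{\frac12\boldsymbol n^TAD\boldsymbol n+\boldsymbol n^T\boldsymbol b_{r+1}}+q^{\frac12\boldsymbol n^TAD\boldsymbol n+\boldsymbol n^T\widetilde{\boldsymbol b}_{r+1}+\frac{r-3}2}}{(q^2;q^2)_{n_1}(q^2;q^2)_{n_2}\cdots(q^2;q^2)_{n_{r-1}}(q;q)_{n_r}}$$ $$=\frac{(q^{8r+4},q^{8r-8},q^{16r-4};q^{16r-4})_\infty}{(q,q^3,q^4;q^4)_\infty}+q^{\frac{r-3}2}\frac{(-q^3,q^{4r-4},-q^{4r-1};-q^{4r-1})_\infty}{(q^2,q^2,q^4;q^4)_\infty}.$$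
   Context: Here $q=e^{2\pi i\tau}$ with $\mathrm{Im}\,\tau>0$, $q^x=e^{2\pi ix\tau}$ for rational $x$; $\mathbb{N}=\{0,1,2,\ldots\}$; $(a;p)_\infty=\prod_{n\ge0}(1-ap^n)$, $(a;p)_n=\prod_{k=0}^{n-1}(1-ap^k)$, $(a_1,\ldots,a_k;p)_\infty=\prod_i(a_i;p)_\infty$ for $|p|<1$. *)

(* Defs.v *)
From HB Require Import structures.
From mathcomp Require Import all_boot all_order all_algebra finmap complex.
From mathcomp Require Import all_classical all_reals all_analysis.
From mathcomp Require Export showcase.summability.

Set Implicit Arguments.
Unset Strict Implicit.
Unset Printing Implicit Defensive.

Import Order.TTheory GRing.Theory Num.Theory.
Import numFieldNormedType.Exports.

Local Open Scope classical_set_scope.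
Local Open Scope ring_scope.
Local Open Scope complex_scope.

(* The family f is summable (unconditionally: along the finite subsets of I,
   ordered by inclusion) with sum s.  Stated over an abstract numFieldType so
   that it applies to R[i], which carries no topology of its own but inherits
   one as a numFieldType. *)
Definition has_sum (K : numFieldType) (I : choiceType) (f : I -> K) (s : K) :
  Prop := partial_sum f A @[A --> totally] --> s.

Section QPochhammer.
Variable K : numFieldType.

Definition qpoch (a p : K) (n : nat) : K := \prod_(k < n) (1 - a * p ^+ k).

(* Meaningful for `|p| < 1, where the partial products converge. *)
Definition qpoch_inf (a p : K) : K := lim (qpoch a p n @[n --> \oo]).

Definition qpochs_inf (s : seq K) (p : K) : K := \prod_(a <- s) qpoch_inf a p.

End QPochhammer.

Section Nome.
Variable R : realType.

Definition cexp (z : R[i]) : R[i] :=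
  (expR (complex.Re z))%:C * (cos (complex.Im z) +i* sin (complex.Im z)).

(* q^x = e^{2 pi i x tau} for rational x. *)
Definition qpow (tau : R[i]) (x : rat) : R[i] :=
  cexp ((0 +i* (2 * pi * ratr x)) * tau).

End Nome.

(* Entries in the 1-based indexing 1 <= i, j <= r. *)
Definition AD_entry (r i j : nat) : nat :=
  if i == 1%N then
    (if j == 1%N then 2 else if j == r then 1 else 0)%N
  else if j == 1%N then
    (if i == r then 1 else 0)%N
  else if i == r then
    (if j == r then r - 1 else 2 * (j - 1))%N
  else
    (if j == r then 2 * (i - 1) else 4 * (minn i j - 1))%N.

Definition AD (r : nat) : 'M[rat]_r :=
  \matrix_(i, j) (AD_entry r i.+1 j.+1)%:R.

Definition bvec (r : nat) : 'cV[rat]_r := \col_i (i.+1 == r)%:R.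

Definition btilde_entry (r i : nat) : nat :=
  if i == 1%N then 1%N else if i == r then r else (2 * (i - 1))%N.

Definition btilde (r : nat) : 'cV[rat]_r := \col_i (btilde_entry r i.+1)%:R.

Definition vecQ (r : nat) (n : 'cV[nat]_r) : 'cV[rat]_r :=
  map_mx (fun k : nat => k%:R) n.

(* (1/2) n^T A n + n^T b; the matrix expressions are 1 x 1. *)
Definition nahm_exponent (r : nat) (A : 'M[rat]_r) (b : 'cV[rat]_r)
    (n : 'cV[nat]_r) : rat :=
  2^-1 * ((vecQ n)^T *m A *m vecQ n) 0 0 + ((vecQ n)^T *m b) 0 0.

(* (q^2;q^2)_{n_1} ... (q^2;q^2)_{n_{r-1}} (q;q)_{n_r} *)
Definition AD_denominator (K : numFieldType) (q : K) (r : nat)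
    (n : 'cV[nat]_r) : K :=
  \prod_(i < r) (if i.+1 == r then qpoch q q (n i 0)
                 else qpoch (q ^+ 2) (q ^+ 2) (n i 0)).

(* Main.v *)
(* Write p = q^2, s = q^(1/2) and M = n_r for the first summand, M = n_r + 1 for
   the second one.  With suffix sums x_i = n_i + ... + n_(r-1) + floor(M / 2),
   completing the square gives, in both cases, a weight in which n_1 only enters
   through Euler's expansion of (- q^(1 + M); p)_oo, while n_2, ..., n_(r-1) run
   along a Bailey chain.  The two summands then combine into the seed of the
   chain: for M even it is

     sum_k (-1)^k p^(3 k^2 - 3 k) / ((p)_(n - 2k) (p)_(n + 2k))
       = p^(n - 1) (1 + p - p^n) / ((p; p^2)_n (p)_n),

   and for M odd, with u = - q,

     sum_k (-1)^k u^(3 k (k - 1) / 2) / ((p)_(n - k) (p)_(n + k + 1))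
       = u^(2 n) (1 + u^2 + u^(2 n + 1)) / ((- u; u^2)_(n + 1) (u^4; u^4)_n);

   both follow from known pairs by WZ certificates.  The Jacobi triple product
   evaluates the two theta series that remain: the first product is the
   contribution of even M, the second one that of odd M.

   All of this is carried out on finite sums: with the factors
   (p)_A / (p)_(A - n) inserted as cutoffs, Euler's expansion, the Bailey chain and
   the triple product are exact finite identities, and only the resulting identity
   is passed to the limit, by dominated convergence.  *)

Require Import Defs.
From HB Require Import structures.
From mathcomp Require Import all_boot all_order all_algebra finmap complex.
From mathcomp Require Import all_classical all_reals all_analysis.
From mathcomp Require Import ring lra zify.

Set Implicit Arguments.
Unset Strict Implicit.
Unset Printing Implicit Defensive.

Import Order.TTheory GRing.Theory Num.Theory.
Import numFieldNormedType.Exports.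

Local Open Scope ring_scope.
Local Open Scope complex_scope.

(** * Bilateral sums and inverse q-factorials *)

(* [k (k - 1) / 2], as a natural number. *)
Definition tri (k : int) : nat :=
  match k with Posz n => 'C(n, 2) | Negz n => 'C(n.+2, 2) end.

Lemma triE (k : int) : ((tri k)%:Z *+ 2 = k * (k - 1))%R.
Proof.
have bin2Z n : (('C(n, 2))%:Z *+ 2 = n%:Z * (n%:Z - 1))%R.
  by elim: n => // n IHn; rewrite binS bin1 PoszD mulrnDl IHn; lia.
by case: k => n; rewrite /tri bin2Z //; lia.
Qed.

Lemma triS (k : int) : ((tri (k + 1))%:Z = (tri k)%:Z + k)%R.
Proof. by have := triE k; have := triE (k + 1); nia. Qed.

Lemma triN (k : int) : ((tri (- k))%:Z = (tri k)%:Z + k)%R.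
Proof. by have := triE k; have := triE (- k); nia. Qed.

Lemma triN1B (k : int) : ((tri (- 1 - k))%:Z = (tri k)%:Z + k *+ 2 + 1)%R.
Proof. by have := triE k; have := triE (- 1 - k); nia. Qed.

Section BilateralSum.
Variable V : numFieldType.
Implicit Types F G : int -> V.

(* The sum of [F k] over [- b <= k < a]. *)
Definition bisum F (a b : nat) : V :=
  \sum_(0 <= k < a) F k%:Z + \sum_(0 <= k < b) F (- 1 - k%:Z).

Lemma eq_bisum F G a b : F =1 G -> bisum F a b = bisum G a b.
Proof. by move=> eFG; congr (_ + _); apply: eq_bigr. Qed.

Lemma bisumD F G a b :
  bisum (fun k => F k + G k) a b = bisum F a b + bisum G a b.
Proof. by rewrite /bisum !big_split /= addrACA. Qed.

Lemma bisum_reflN1 F a b : bisum (fun k => F (- 1 - k)) a b = bisum F b a.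
Proof.
rewrite /bisum addrC; congr (_ + _); apply: eq_bigr => k _.
by congr F; lia.
Qed.

(** The fixed point 0 stays in the nonnegative half, so the lengths [a.+1] and [b] become [b.+1] and
    [a]. *)
Lemma bisum_reflN F a b : bisum (fun k => F (- k)) a.+1 b = bisum F b.+1 a.
Proof.
rewrite /bisum !big_nat_recl //= oppr0 -!addrA; congr (_ + _).
rewrite addrC; congr (_ + _); apply: eq_bigr => k _; congr F; lia.
Qed.

Lemma bisum_telescope G a b :
  bisum (fun k => G (k + 1) - G k) a b = G a%:Z - G (- b%:Z).
Proof.
have -> : G a%:Z - G (- b%:Z) = (G a%:Z - G 0) + (G 0 - G (- b%:Z)).
  by rewrite addrA subrK.
congr (_ + _).
  rewrite -(telescope_sumr (fun k => G k%:Z)) //.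
  by apply: eq_bigr => k _; rewrite -addn1 PoszD.
have /= := telescope_sumr (fun k : nat => G (- k%:Z)) (leq0n b).
rewrite oppr0 => H; apply: oppr_inj; rewrite opprB -H -sumrN.
apply: eq_bigr => k _; rewrite opprB; congr (G _ - G _); lia.
Qed.

Lemma bisum_sum (F : nat -> int -> V) M a b :
  \sum_(0 <= n < M) bisum (F n) a b =
  bisum (fun k => \sum_(0 <= n < M) F n k) a b.
Proof.
by rewrite /bisum big_split /=; congr (_ + _); rewrite exchange_big.
Qed.

End BilateralSum.

Lemma bisumZ (K : numFieldType) (c : K) (F : int -> K) a b :
  bisum (fun k => c * F k) a b = c * bisum F a b.
Proof. by rewrite /bisum mulrDr !mulr_sumr. Qed.

(* The WZ method: a certificate G that vanishes at both ends. *)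
Lemma bisum_wz (K : numFieldType) (c d : K) (F F' G : int -> K) a b :
    (forall k, c * F k = d * F' k + (G (k + 1) - G k)) ->
    G a%:Z = 0 -> G (- b%:Z) = 0 ->
  c * bisum F a b = d * bisum F' a b.
Proof.
move=> FG Ga Gb; rewrite -!bisumZ (eq_bisum _ _ FG) bisumD bisum_telescope.
by rewrite Ga Gb subrr addr0.
Qed.

Section InverseQFactorial.
Variables (K : numFieldType) (p : K).
Hypothesis p0 : p != 0.
Hypothesis p1 : forall n, p ^+ n.+1 != 1.

(* [1 / (p; p)_z], which vanishes for [z < 0]: sums over all integers with
   summands containing [iqfact] are thus finite. *)
Definition iqfact (z : int) : K :=
  if z is Posz n then (qpoch p p n)^-1 else 0.

#[global] Arguments iqfact : simpl never.

Lemma qpochS (a x : K) n : qpoch a x n.+1 = qpoch a x n * (1 - a * x ^+ n).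
Proof. by rewrite /qpoch big_ord_recr. Qed.

Lemma qpoch0 (a x : K) : qpoch a x 0 = 1.
Proof. by rewrite /qpoch big_ord0. Qed.

Lemma qfact_neq0 n : qpoch p p n != 0.
Proof.
rewrite /qpoch; apply/prodf_neq0 => i _.
by rewrite -exprS subr_eq0 eq_sym p1.
Qed.

Lemma iqfact0 : iqfact 0 = 1.
Proof. by rewrite /iqfact /= qpoch0 invr1. Qed.

Lemma iqfact_neg (z : int) : z < 0 -> iqfact z = 0.
Proof. by case: z. Qed.

(** At z = 0 the factor 1 - p^0 vanishes together with the left side. As no integer is excluded, one
    rational identity verifies a WZ certificate at every index. *)
Lemma iqfactB1 (z : int) : iqfact (z - 1) = (1 - p ^ z) * iqfact z.
Proof.
case: z => [[|n]|n]; first by rewrite expr0z subrr mul0r.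
  have -> : n.+1%:Z - 1 = n%:Z by lia.
  rewrite /iqfact qpochS -exprS invfM mulrCA -exprnP mulfV ?mulr1 //.
  by rewrite subr_eq0 eq_sym p1.
by rewrite /iqfact mulr0.
Qed.

Lemma iqfactE n : iqfact n%:Z = (qpoch p p n)^-1. Proof. by []. Qed.

Let expp (m n : int) : p ^ (m + n) = p ^ m * p ^ n.
Proof. exact: expfzDr. Qed.

Lemma qbinomial_rec (A B : nat) (x : K) a b : x != 0 ->
    (A.+1 < a)%N -> (B <= b)%N ->
  (1 - p ^+ (A.+1 + B)) *
    bisum (fun k => p ^+ tri k * x ^ k * iqfact (A.+1%:Z - k) * iqfact (B%:Z + k)) a b =
  (1 + x * p ^+ A) *
    bisum (fun k => p ^+ tri k * x ^ k * iqfact (A%:Z - k) * iqfact (B%:Z + k)) a b.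
Proof.
move=> x0 Aa Bb.
(* The certificate is a monomial times the summand for A + 1 with B + k lowered by one; A + 1 < a
   and B <= b make it vanish at the two ends. *)
pose G (k : int) := - p ^ (A.+1%:Z - k) *
  (p ^+ tri k * x ^ k * iqfact (A.+1%:Z - k) * iqfact (B%:Z + k - 1)).
apply: (@bisum_wz _ _ _ _ _ G) => [k||]; rewrite /G; first last.
- by rewrite (iqfact_neg (_ : B%:Z - b%:Z - 1 < 0)) ?(mulr0, mul0r) //; lia.
- by rewrite (iqfact_neg (_ : A.+1%:Z - a%:Z < 0)) ?(mulr0, mul0r) //; lia.
have -> : A.+1%:Z - (k + 1) = A%:Z - k by lia.
have -> : B%:Z + (k + 1) - 1 = B%:Z + k by lia.
have -> : A%:Z - k = A.+1%:Z - k - 1 by lia.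
rewrite !iqfactB1 !exprnP triS PoszD -(addn1 A) PoszD !expp !expfzDr // !expr1z.
set W1 := iqfact _; set W2 := iqfact _; rewrite -!invr_expz ?expr1z.
by field; rewrite p0 expfz_neq0.
Qed.

Lemma qbinomial0 (x : K) a b : (0 < a)%N ->
  bisum (fun k => p ^+ tri k * x ^ k * iqfact (0 - k) * iqfact (0 + k)) a b = 1.
Proof.
case: a => // a _; rewrite /bisum big_nat_recl // big1_seq => [|k _]; last first.
  by rewrite (iqfact_neg (_ : 0 - k.+1%:Z < 0)) ?mulr0 ?mul0r //; lia.
rewrite big1_seq => [|k _]; last first.
  by rewrite (iqfact_neg (_ : 0 + (- 1 - k%:Z) < 0)) ?mulr0 //; lia.
by rewrite subr0 addr0 iqfact0 /= expr0 expr0z !mulr1 !addr0.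
Qed.

(** Iterating [qbinomial_rec] down to A = 0 collects the factors 1 + x p^i into the product, while
    the factors 1 - p^(i + B) form the ratio of the two inverse factorials. *)
Lemma qbinomial_left (A B : nat) (x : K) a b : x != 0 -> (A < a)%N -> (B <= b)%N ->
  iqfact B%:Z *
  bisum (fun k => p ^+ tri k * x ^ k * iqfact (A%:Z - k) * iqfact (B%:Z + k)) a b =
  qpoch (- x) p A * iqfact (A + B)%N%:Z *
  bisum (fun k => p ^+ tri k * x ^ k * iqfact (0 - k) * iqfact (B%:Z + k)) a b.
Proof.
move=> x0 + Bb; elim: A => [|A IHA] Aa; first by rewrite qpoch0 mul1r.
have d0 : 1 - p ^+ (A.+1 + B) != 0 by rewrite addSn subr_eq0 eq_sym p1.
have IH := IHA (ltnW Aa); have rec := qbinomial_rec x0 Aa Bb.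
apply: (mulfI d0); rewrite [LHS]mulrCA rec [LHS]mulrCA IH.
have -> : iqfact (A + B)%N = (1 - p ^+ (A.+1 + B)) * iqfact (A.+1 + B)%N.
  by rewrite exprnP -iqfactB1; congr iqfact; lia.
by rewrite qpochS; ring.
Qed.

(* [A = B] is the finite form of the Jacobi triple product identity, and
   [B = 0] the finite form of Euler's expansion of [(- x; p)_oo]. *)
Lemma qbinomial_bilateral (A B : nat) (x : K) a b :
    x != 0 -> (A < a)%N -> (B <= b)%N ->
  bisum (fun k => p ^+ tri k * x ^ k * iqfact (A%:Z - k) * iqfact (B%:Z + k)) a b =
  qpoch (- x) p A * qpoch (- (p / x)) p B * iqfact (A + B)%N%:Z.
Proof.
move=> x0 Aa Bb.
have wB0 : iqfact B%:Z != 0 by rewrite invr_neq0 ?qfact_neq0.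
apply: (mulfI wB0); rewrite qbinomial_left //.
(* Reflecting k to - k exchanges [A] with [B] and [x] with [p / x], so [qbinomial_left] also
   evaluates the sum left over at A = 0. *)
case: a Aa => // a Aa; rewrite -bisum_reflN.
rewrite (@eq_bisum _ _ (fun k =>
    p ^+ tri k * (p / x) ^ k * iqfact (B%:Z - k) * iqfact (0%:Z + k))); last first.
  by move=> k; rewrite !exprnP triN expp expfzMl exprz_inv opprK !add0r; ring.
have := @qbinomial_left B 0 (p / x) b.+1 a; rewrite qbinomial0 // mulr1.
rewrite iqfact0 mul1r addn0 => -> //; last by rewrite mulf_neq0 ?invr_neq0.
by ring.
Qed.

(** For N < k both sides vanish, for N = k only n = k survives, and a WZ pair gives the induction
    step in N - k. *)
Lemma bailey_sum_nat (N k e M : nat) : (N < M)%N ->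
  bisum (fun n => p ^ (n * n + e%:Z * n) * iqfact (N%:Z - n) *
                  iqfact (n - k%:Z) * iqfact (n + k%:Z + e%:Z)) M 0 =
  p ^ (k%:Z * k%:Z + e%:Z * k%:Z) * iqfact (N%:Z - k%:Z) *
  iqfact (N%:Z + k%:Z + e%:Z).
Proof.
have [Nk NM|kN] := ltnP N k.
  rewrite (iqfact_neg (_ : N%:Z - k%:Z < 0)) ?mulr0 ?mul0r; last by lia.
  rewrite /bisum [X in _ + X]big_nil addr0 big1_seq // => n _.
  have [nN|nN] := ltnP N n.
    by rewrite (iqfact_neg (_ : N%:Z - n%:Z < 0)) ?mulr0 ?mul0r //; lia.
  by rewrite (iqfact_neg (_ : n%:Z - k%:Z < 0)) ?mulr0 ?mul0r //; lia.
rewrite -(subnKC kN); elim: (N - k)%N => {N kN} [|A IHA] AM.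
  rewrite addn0 in AM *; rewrite /bisum [X in _ + X]big_nil addr0.
  rewrite (big_cat_nat (leq0n k) (ltnW AM)) /= big1_seq ?add0r; last first.
    move=> n; rewrite mem_index_iota => nk.
    by rewrite (iqfact_neg (_ : n%:Z - k%:Z < 0)) ?mulr0 ?mul0r //; lia.
  rewrite big_ltn // big1_seq ?addr0; last first.
    move=> n; rewrite mem_index_iota => nk.
    by rewrite (iqfact_neg (_ : k%:Z - n%:Z < 0)) ?mulr0 ?mul0r //; lia.
  by rewrite subrr iqfact0; ring.
have d0 : (1 - p ^+ A.+1) * (1 - p ^+ (A.+1 + (k + k + e))) != 0.
  by rewrite addSn mulf_neq0 // subr_eq0 eq_sym p1.
apply: (mulfI d0).
(* The certificate is a monomial times the summand with both n - k and n + k + e lowered by one. *)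
pose G (n : int) := - p ^ ((k + A.+1)%N%:Z - n) * (p ^ (n * n + e%:Z * n) *
  iqfact ((k + A.+1)%N%:Z - n) * iqfact (n - k%:Z - 1) * iqfact (n + k%:Z + e%:Z - 1)).
transitivity (1 * bisum (fun n => p ^ (n * n + e%:Z * n) * iqfact ((k + A)%N%:Z - n) *
                  iqfact (n - k%:Z) * iqfact (n + k%:Z + e%:Z)) M 0).
  apply: (@bisum_wz _ _ _ _ _ G) => [n||]; rewrite /G; first last.
  - by rewrite (iqfact_neg (_ : - 0%:Z - k%:Z - 1 < 0)) ?(mulr0, mul0r) //; lia.
  - by rewrite (iqfact_neg (_ : (k + A.+1)%N%:Z - M%:Z < 0)) ?(mulr0, mul0r) //; lia.
  have -> : (k + A.+1)%N%:Z - (n + 1) = (k + A.+1)%N%:Z - n - 1 by lia.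
  have -> : n + 1 - k%:Z - 1 = n - k%:Z by lia.
  have -> : n + 1 + k%:Z + e%:Z - 1 = n + k%:Z + e%:Z by lia.
  have -> : (k + A)%N%:Z - n = (k + A.+1)%N%:Z - n - 1 by lia.
  have -> : (n + 1) * (n + 1) + e%:Z * (n + 1) =
      (n * n + e%:Z * n) + n + n + e%:Z + 1 by ring.
  rewrite !iqfactB1 -addn1 !exprnP !PoszD !expp ?expr1z.
  set W1 := iqfact _; set W2 := iqfact _; set W3 := iqfact _.
  rewrite -!invr_expz ?expr1z.
  by field; rewrite p0 !expfz_neq0.
rewrite mul1r IHA; last by lia.
have -> : (k + A)%N%:Z - k%:Z = A.+1%:Z - 1 by lia.
have -> : (k + A)%N%:Z + k%:Z + e%:Z = (A.+1 + (k + k + e))%N%:Z - 1 by lia.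
rewrite !iqfactB1.
have -> : (k + A.+1)%N%:Z - k%:Z = A.+1 by lia.
have -> : (k + A.+1)%N%:Z + k%:Z + e%:Z = (A.+1 + (k + k + e))%N%:Z by lia.
by rewrite !exprnP; ring.
Qed.

(* The q-Vandermonde sum behind the Bailey lemma; the parameter [e] is the parity
   that lets [n] and [k] stand for [n + e / 2] and [k + e / 2]. *)
Lemma bailey_sum (N e M : nat) (k : int) : (e <= 1)%N -> (N < M)%N ->
  bisum (fun n => p ^ (n * n + e%:Z * n) * iqfact (N%:Z - n) *
                  iqfact (n - k) * iqfact (n + k + e%:Z)) M 0 =
  p ^ (k * k + e%:Z * k) * iqfact (N%:Z - k) * iqfact (N%:Z + k + e%:Z).
Proof.
move=> e1 NM; case: k => [k|k]; first exact: bailey_sum_nat.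
(* The map k -> - k - e swaps the two inverse factorials and fixes k^2 + e k. By e <= 1 it sends a
   negative index to a natural number. *)
have kE : Negz k = - ((k.+1 - e)%N%:Z) - e%:Z by lia.
have := @bailey_sum_nat N (k.+1 - e) e M NM; set k' := (k.+1 - e)%N in kE *.
rewrite kE => H.
have -> : (- k'%:Z - e%:Z) * (- k'%:Z - e%:Z) + e%:Z * (- k'%:Z - e%:Z) =
   k'%:Z * k'%:Z + e%:Z * k'%:Z by ring.
have -> : N%:Z - (- k'%:Z - e%:Z) = N%:Z + k'%:Z + e%:Z by ring.
have -> : N%:Z + (- k'%:Z - e%:Z) + e%:Z = N%:Z - k'%:Z by ring.
rewrite mulrAC -H; apply: eq_bisum => n.
have -> : n - (- k'%:Z - e%:Z) = n + k'%:Z + e%:Z by ring.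
have -> : n + (- k'%:Z - e%:Z) + e%:Z = n - k'%:Z by ring.
by rewrite mulrAC.
Qed.

End InverseQFactorial.

(** * The two Bailey pairs *)

Lemma expN1z (K : numFieldType) (k : int) : (-1) ^ (- k) = (-1) ^ k :> K.
Proof. by rewrite -exprz_inv invrN1. Qed.

Section EvenPair.
Variables (K : numFieldType) (p : K).
Hypothesis p0 : p != 0.
Hypothesis p1 : forall n, p ^+ n.+1 != 1.
Local Notation w := (iqfact p).

Let expp (m n : int) : p ^ (m + n) = p ^ m * p ^ n.
Proof. exact: expfzDr. Qed.

Let F (k : int) : K := (-1) ^ k * p ^+ (6 * tri k).

Let FS k : F (k + 1) = - F k * (p ^ k) ^+ 6.
Proof.
rewrite /F expfzDr ?oppr_eq0 ?oner_eq0 // expr1z ![(6 * tri _)%N]mulnC !exprM.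
have -> : p ^+ tri (k + 1) = p ^+ tri k * p ^ k by rewrite !exprnP triS expp.
by ring.
Qed.

Let FN k : F (- k) = F k * (p ^ k) ^+ 6.
Proof.
rewrite /F expN1z ![(6 * tri _)%N]mulnC !exprM.
have -> : p ^+ tri (- k) = p ^+ tri k * p ^ k by rewrite !exprnP triN expp.
by ring.
Qed.

Let ww (n : nat) (k : int) : K := w (n%:Z - k - k) * w (n%:Z + k + k).

Let wwN n k : ww n (- k) = ww n k.
Proof. by rewrite /ww !opprK mulrC. Qed.

(* The inner sum of Slater's Bailey pair C(1). *)
Let T (L n : nat) : K :=
  bisum (fun k => F k * (p ^ k) ^+ 2 * ww n k) L.+1 L.

Let T_sym L n :
  2 * T L n = bisum (fun k => F k * (p ^ k) ^+ 2 * (1 + (p ^ k) ^+ 2) * ww n k) L.+1 L.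
Proof.
rewrite mulr_natl mulr2n {2}/T -bisum_reflN -bisumD; apply: eq_bisum => k.
rewrite FN wwN -invr_expz; field.
by rewrite expfz_neq0.
Qed.

(** The added factor lowers [n] by one in [ww], so for n > 0 this is a recurrence for [T]. The
    unreduced form also covers n = 0 and is reused in [even_bailey_pair]. *)
Let T_wz L n : (n <= L)%N ->
  (1 - p ^+ n ^+ 2 / p) * (1 - p ^+ n) * (2 * T L n) =
  1 * bisum (fun k => F k * (p ^ k) ^+ 2 * (1 + (p ^ k) ^+ 2) *
     ((1 - p ^+ n / (p ^ k) ^+ 2) * (1 - p ^+ n * (p ^ k) ^+ 2)) * ww n k) L.+1 L.
Proof.
move=> nL; rewrite T_sym.
(* Raising k by one moves both indices by two, hence the double shift in the certificate. *)
pose G k := - p ^ (n%:Z - k - k) * F k * (p ^ k) ^+ 2 *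
  w (n%:Z - k - k) * w (n%:Z + k + k - 1 - 1).
apply: (@bisum_wz _ _ _ _ _ G) => [k||]; rewrite /G; first last.
- by rewrite (iqfact_neg _ (_ : n%:Z + _ + _ - 1 - 1 < 0)) ?mulr0 ?mul0r ?mulr0 //; lia.
- by rewrite (iqfact_neg _ (_ : n%:Z - _ - _ < 0)) ?mulr0 ?mul0r ?mulr0 //; lia.
have -> : n%:Z - (k + 1) - (k + 1) = n%:Z - k - k - 1 - 1 by ring.
have -> : n%:Z + (k + 1) + (k + 1) - 1 - 1 = n%:Z + k + k by ring.
rewrite !iqfactB1 // FS /ww.
set W1 := w _; set W2 := w _; rewrite !expp -!invr_expz !exprnP !expr1z.
by field; rewrite p0 expfz_neq0.
Qed.

Let TE L n : (n <= L)%N -> T L n = (qpoch p (p ^+ 2) n * qpoch p p n)^-1.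
Proof.
elim: n => [|n IHn] nL.
  rewrite /T /bisum big_nat_recl // big1_seq => [|k _]; last first.
    by rewrite /ww (iqfact_neg _ (_ : 0 - k.+1%:Z - _ < 0)) ?mulr0 ?mul0r ?mulr0 //; lia.
  rewrite big1_seq => [|k _]; last first.
    by rewrite /ww (iqfact_neg _ (_ : 0 + (- 1 - k%:Z) + _ < 0)) ?mulr0 ?mul0r ?mulr0 //; lia.
  have t0 : tri 0 = 0%N by [].
  by rewrite /ww /F t0 !(subr0, addr0) iqfact0 !qpoch0 !expr0z expr1n !mulr1 invr1.
have d2 : (2 : K) != 0 by rewrite pnatr_eq0.
have dn : 1 - p ^+ n.+1 != 0 by rewrite subr_eq0 eq_sym p1.
have dn2 : 1 - p * p ^+ 2 ^+ n != 0.
  by rewrite -exprM -exprS subr_eq0 eq_sym p1.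
have := T_wz nL.
rewrite (@eq_bisum _ _ (fun k => F k * (p ^ k) ^+ 2 * (1 + (p ^ k) ^+ 2) * ww n k)).
  rewrite -T_sym mul1r IHn ?(ltnW nL) // mulrCA => /(mulfI d2) H.
  have e2 : 1 - p ^+ n.+1 ^+ 2 / p = 1 - p * p ^+ 2 ^+ n.
    by rewrite exprAC exprS; field.
  rewrite e2 in H.
  apply: (mulfI (mulf_neq0 dn2 dn)); rewrite H !qpochS -exprS mulrACA.
  by rewrite [in RHS]invfM mulrCA mulfV ?mulr1 ?mulf_neq0.
move=> k; rewrite -!mulrA; congr (_ * (_ * (_ * _))); rewrite /ww.
have -> : n%:Z - k - k = n.+1%:Z - k - k - 1 by lia.
have -> : n%:Z + k + k = n.+1%:Z + k + k - 1 by lia.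
rewrite !iqfactB1 //; set W1 := w _; set W2 := w _.
rewrite !expp -!invr_expz !exprnP; field.
by rewrite expfz_neq0.
Qed.

(* With X = p^(2k) and N = p^n, the reflection k -> - k turns 1 + X^3 into
   (1 + X) (X^2 - X + 1), and N (X + 1 / X - 1) is an affine function of
   (1 - N / X) (1 - N X), whose sum against [T] is given by [T_wz]. *)
Lemma even_bailey_pair (L n : nat) : (n <= L)%N ->
  bisum (fun k => (-1) ^ k * p ^+ (6 * tri k) *
                  (w (n%:Z - k - k) * w (n%:Z + k + k))) L.+1 L =
  p ^+ n * (1 + p^-1 - p ^+ n / p) / (qpoch p (p ^+ 2) n * qpoch p p n).
Proof.
move=> nL; rewrite -(TE nL); set S := bisum _ _ _.
have d2 : (2 : K) != 0 by rewrite pnatr_eq0.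
have pn0 : p ^+ n != 0 by rewrite expf_neq0.
apply: (mulfI (mulf_neq0 d2 pn0)).
have S2 : 2 * S = bisum (fun k => F k * (1 + (p ^ k) ^+ 6) * ww n k) L.+1 L.
  have SE : S = bisum (fun k => F k * ww n k) L.+1 L by [].
  rewrite mulr_natl mulr2n {2}SE -bisum_reflN SE -bisumD.
  by apply: eq_bisum => k; rewrite FN wwN; ring.
have : p ^+ n * (2 * S) = (1 + p ^+ n ^+ 2 - p ^+ n) * (2 * T L n) -
   (1 - p ^+ n ^+ 2 / p) * (1 - p ^+ n) * (2 * T L n).
  rewrite T_wz // T_sym S2 mul1r -!bisumZ -mulN1r -bisumZ -bisumD.
  apply: eq_bisum => k; field.
  by rewrite expfz_neq0.
rewrite mulrA [_ * 2]mulrC => ->; by field.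
Qed.

End EvenPair.

Section OddPair.
Variables (K : numFieldType) (u : K).
Hypothesis u0 : u != 0.
Hypothesis u1 : forall n, u ^+ n.+1 != 1.
Hypothesis uN1 : forall n, u ^+ n.+1 != - 1.
Local Notation w := (iqfact (u ^+ 2)).

Let expu (m n : int) : u ^ (m + n) = u ^ m * u ^ n.
Proof. exact: expfzDr. Qed.

Let expu2 (m : int) : (u ^+ 2) ^ m = (u ^ m) ^+ 2.
Proof. by rewrite !exprnP exprzAC. Qed.

Let p1 n : (u ^+ 2) ^+ n.+1 != 1.
Proof. by rewrite -exprM mulnS; apply: u1. Qed.

Let F (k : int) : K := (-1) ^ k * u ^+ (3 * tri k).

Let FS k : F (k + 1) = - F k * (u ^ k) ^+ 3.
Proof.
rewrite /F expfzDr ?oppr_eq0 ?oner_eq0 // expr1z ![(3 * tri _)%N]mulnC !exprM.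
have -> : u ^+ tri (k + 1) = u ^+ tri k * u ^ k by rewrite !exprnP triS expu.
by ring.
Qed.

Let FN1B k : F (- 1 - k) = - F k * (u ^ k) ^+ 6 * u ^+ 3.
Proof.
rewrite /F expfzDr ?oppr_eq0 ?oner_eq0 // !expN1z expr1z ![(3 * tri _)%N]mulnC !exprM.
have -> : u ^+ tri (- 1 - k) = u ^+ tri k * (u ^ k) ^+ 2 * u.
  by rewrite expr2 !exprnP triN1B mulr2n !expu expr1z.
by ring.
Qed.

Let ww (n : nat) (k : int) : K := w (n%:Z - k) * w (n%:Z + k + 1).

Let wwN1B n k : ww n (- 1 - k) = ww n k.
Proof. by rewrite /ww mulrC; congr (w _ * w _); ring. Qed.

(** The companion sum with a pure product value, in the role that Slater's pair has in the even
    case. *)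
Let T (L n : nat) : K :=
  bisum (fun k => F k * (u ^ k) ^+ 4 * ww n k) L.+1 L.+1.

(** The coefficient of [ww] in the summand of [T] plus its mirror image under k -> - 1 - k. *)
Let ts (k : int) : K := F k * ((u ^ k) ^+ 4 - (u ^ k) ^+ 2 / u).

Let T_sym L n : 2 * T L n = bisum (fun k => ts k * ww n k) L.+1 L.+1.
Proof.
rewrite mulr_natl mulr2n {2}/T -bisum_reflN1 -bisumD; apply: eq_bisum => k.
rewrite FN1B wwN1B expu -!invr_expz expr1z /ts; field.
by rewrite u0 expfz_neq0.
Qed.

Let T_wz L n : (n <= L)%N ->
  (1 + u * u ^+ 2 ^+ n) * (1 - (u ^+ 2 ^+ n) ^+ 2) * (2 * T L n) =
  1 * bisum (fun k => ts k *
     ((1 - u ^+ 2 ^+ n / (u ^ k) ^+ 2) *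
      (1 - u ^+ 2 ^+ n * u ^+ 2 * (u ^ k) ^+ 2)) * ww n k) L.+1 L.+1.
Proof.
move=> nL; rewrite T_sym; set N := u ^+ 2 ^+ n.
(* A Laurent polynomial in u^k times the summand with n + k + 1 lowered to n + k. *)
pose G k := F k * (u ^ k) ^+ 4 *
  (N / u * ((u ^ k) ^- 4 + N * (u ^ k) ^- 3 - N * (u ^ k) ^- 2 - (u ^ k)^-1)) *
  w (n%:Z - k) * w (n%:Z + k).
apply: (@bisum_wz _ _ _ _ _ G) => [k||]; rewrite /G; first last.
- by rewrite (iqfact_neg _ (_ : n%:Z + - L.+1%:Z < 0)) ?mulr0 ?mul0r ?mulr0 //; lia.
- by rewrite (iqfact_neg _ (_ : n%:Z - _ < 0)) ?mulr0 ?mul0r ?mulr0 //; lia.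
have -> : n%:Z - (k + 1) = n%:Z - k - 1 by ring.
have -> : n%:Z + (k + 1) = n%:Z + k + 1 by ring.
have -> : n%:Z + k = n%:Z + k + 1 - 1 by ring.
rewrite /ww; have -> : n%:Z + k + 1 - 1 + 1 = n%:Z + k + 1 by ring.
rewrite !iqfactB1 ?expf_neq0 // FS /ts.
set W1 := w _; set W2 := w _; rewrite !expu2 !expu -!invr_expz !expr1z.
have -> : N = (u ^ n%:Z) ^+ 2 by rewrite -exprnP /N exprAC.
by field; rewrite u0 expfz_neq0.
Qed.

Let TE L n : (n <= L)%N ->
  T L n = - u^-1 / (qpoch (- u) (u ^+ 2) n.+1 * qpoch (u ^+ 4) (u ^+ 4) n).
Proof.
elim: n => [|n IHn] nL.
  rewrite /T /bisum !big_nat_recl // big1_seq => [|k _]; last first.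
    by rewrite /ww (iqfact_neg _ (_ : 0 - k.+1%:Z < 0)) ?mulr0 ?mul0r ?mulr0 //; lia.
  rewrite big1_seq => [|k _]; last first.
    by rewrite /ww (iqfact_neg _ (_ : 0 + (- 1 - k.+1%:Z) + _ < 0)) ?mulr0 ?mul0r ?mulr0 //; lia.
  have := FN1B 0; rewrite !subr0 => ->; have := wwN1B 0 0; rewrite subr0 => ->.
  have t0 : tri 0 = 0%N by [].
  rewrite /ww /F t0 subr0 !addr0 !add0r iqfact0 -invr_expz !expr0z !expr1z.
  rewrite /iqfact /= !qpochS !qpoch0 !expr0 !mulr1 !mul1r.
  have a1 : 1 - u ^+ 2 != 0 by rewrite subr_eq0 eq_sym u1.
  have a2 : 1 + u != 0 by rewrite addrC -[1]opprK subr_eq0; apply: (uN1 0).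
  by field; rewrite u0 a1 opprK a2.
have d2 : (2 : K) != 0 by rewrite pnatr_eq0.
have dn : 1 + u * u ^+ 2 ^+ n.+1 != 0.
  by rewrite -exprM -exprS addrC -[1]opprK subr_eq0 uN1.
have dn2 : 1 - (u ^+ 2 ^+ n.+1) ^+ 2 != 0.
  rewrite -!exprM subr_eq0 eq_sym; set m := (_ * _)%N.
  by have -> : m = (4 * n + 3).+1 by lia.
have := T_wz nL.
rewrite (@eq_bisum _ _ (fun k => ts k * ww n k)).
  rewrite -T_sym mul1r IHn ?(ltnW nL) // mulrCA => /(mulfI d2) H.
  apply: (mulfI (mulf_neq0 dn dn2)); rewrite H.
  rewrite [qpoch _ _ n.+2]qpochS [qpoch (u ^+ 4) _ n.+1]qpochS [- u * _]mulNr opprK.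
  have -> : u ^+ 4 * u ^+ 4 ^+ n = (u ^+ 2 ^+ n.+1) ^+ 2.
    by rewrite -exprS -!exprM; congr (_ ^+ _); lia.
  move: (qpoch _ _ _) (qpoch _ _ _) => B A.
  rewrite [A * _ * _]mulrACA [(A * B * _)^-1]invfM [RHS]mulrCA.
  by rewrite [_ * (_^-1 / _)]mulrCA mulfV ?mulr1 ?mulf_neq0.
move=> k; rewrite -!mulrA; congr (_ * _); rewrite /ww.
have -> : n%:Z - k = n.+1%:Z - k - 1 by lia.
have -> : n%:Z + k + 1 = n.+1%:Z + k + 1 - 1 by lia.
rewrite !iqfactB1 ?expf_neq0 //; set W1 := w _; set W2 := w _.
rewrite !expu2 !expu -!invr_expz expr1z -!exprnP [u ^+ 2 ^+ _]exprAC; field.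
by rewrite expfz_neq0.
Qed.

(* As for [even_bailey_pair], with the reflection k -> - 1 - k. *)
Lemma odd_bailey_pair (L n : nat) : (n <= L)%N ->
  bisum (fun k => (-1) ^ k * u ^+ (3 * tri k) *
                  (w (n%:Z - k) * w (n%:Z + k + 1))) L.+1 L.+1 =
  u ^+ 2 ^+ n * (1 + u ^+ 2 + u * u ^+ 2 ^+ n) /
    (qpoch (- u) (u ^+ 2) n.+1 * qpoch (u ^+ 4) (u ^+ 4) n).
Proof.
move=> nL; have := TE nL; set S := bisum _ _ _; set D := _ * qpoch _ _ _ => TD.
have -> : D^-1 = - u * T L n by rewrite TD mulrA mulrNN mulfV // mul1r.
have d2 : (2 : K) != 0 by rewrite pnatr_eq0.
set N := u ^+ 2 ^+ n.
have n0 : N != 0 by rewrite !expf_neq0.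
apply: (mulfI (mulf_neq0 d2 n0)).
have S2 : 2 * S = bisum (fun k => F k * (1 - u ^+ 3 * (u ^ k) ^+ 6) * ww n k) L.+1 L.+1.
  have SE : S = bisum (fun k => F k * ww n k) L.+1 L.+1 by [].
  rewrite mulr_natl mulr2n {2}SE -bisum_reflN1 SE -bisumD.
  by apply: eq_bisum => k; rewrite FN1B wwN1B; ring.
have : N * (2 * S) = (- u * (1 + N ^+ 2 * u ^+ 2 + u * N)) * (2 * T L n) +
   u * ((1 + u * N) * (1 - N ^+ 2) * (2 * T L n)).
  rewrite T_wz // T_sym S2 mul1r -!bisumZ -bisumD.
  apply: eq_bisum => k; rewrite /ts -/N; field.
  by rewrite u0 expfz_neq0.
by rewrite mulrA [_ * 2]mulrC => ->; ring.
Qed.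

End OddPair.

(** * The Bailey chain as a sum over vectors *)

Fixpoint words (k B : nat) : seq (seq nat) :=
  if k is k'.+1 then [seq x :: l | x <- iota 0 B, l <- words k' B]
  else [:: [::]].

Lemma big_words_cons (V : nmodType) (F : seq nat -> V) k B :
  \sum_(l <- words k.+1 B) F l =
  \sum_(0 <= x < B) \sum_(l <- words k B) F (x :: l).
Proof. by rewrite /= big_allpairs_dep /index_iota subn0. Qed.

(** Lets a suffix sum replace an entry as summation variable: the summand vanishes below [c] and
    from [B] on, so the range can stay the same. *)
Lemma big_nat_shift (V : nmodType) (H : nat -> V) (B c : nat) :
    (forall x, (x < c)%N -> H x = 0) -> (forall x, (B <= x)%N -> H x = 0) ->
  \sum_(0 <= a < B) H (a + c)%N = \sum_(0 <= x < B) H x.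
Proof.
move=> Hc HB; have := big_addn 0 (B + c) c xpredT H.
rewrite add0n addnK => <-.
have : \sum_(0 <= x < B + c) H x = \sum_(0 <= x < B) H x.
  rewrite (big_cat_nat (leq0n B) (leq_addr c B)) /=.
  rewrite [X in _ + X]big1_seq ?addr0 // => x.
  by rewrite mem_index_iota => /= /andP[/HB].
rewrite (big_cat_nat (leq0n c) (leq_addl B c)) /=.
rewrite big1_seq ?add0r // => x.
by rewrite mem_index_iota => /= /Hc.
Qed.

Section BaileyChain.
Variables (K : numFieldType) (p : K).
Hypothesis p0 : p != 0.
Hypothesis p1 : forall n, p ^+ n.+1 != 1.
Local Notation w := (iqfact p).
Variable e : nat.
Hypothesis e1 : (e <= 1)%N.

(** The Bailey lemma relative to a = p^e with both free parameters sent to infinity, acting on the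
    beta sequence. *)
Definition bailey_step (B : nat) (f : nat -> K) (L : nat) : K :=
  \sum_(0 <= n < B) p ^+ (n * n + e * n) * w (L%:Z - n%:Z) * f n.

(** [kappa] places the alpha sequence on its support: k -> 2 k for the even pair, the identity for
    the odd one. By [bailey_sum] a step only multiplies each alpha by a power of [p]. *)
Lemma bailey_step_pair (B a b : nat) (alpha : int -> K) (kappa : int -> int)
    (f : nat -> K) :
    (forall n, (n < B)%N -> f n = bisum (fun k => alpha k *
       (w (n%:Z - kappa k) * w (n%:Z + kappa k + e%:Z))) a b) ->
  forall L, (L < B)%N ->
  bailey_step B f L =
  bisum (fun k => p ^ (kappa k * kappa k + e%:Z * kappa k) * alpha k *
       (w (L%:Z - kappa k) * w (L%:Z + kappa k + e%:Z))) a b.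
Proof.
move=> fE L LB; rewrite /bailey_step.
transitivity (\sum_(0 <= n < B) bisum (fun k => alpha k *
   (p ^ (n%:Z * n%:Z + e%:Z * n%:Z) * w (L%:Z - n%:Z) *
    w (n%:Z - kappa k) * w (n%:Z + kappa k + e%:Z))) a b).
  apply: eq_big_nat => n nB; rewrite fE // -bisumZ; apply: eq_bisum => k.
  by rewrite -!PoszM -PoszD -exprnP; ring.
rewrite bisum_sum; apply: eq_bisum => k; rewrite -mulr_sumr.
have := bailey_sum p0 p1 (kappa k) e1 LB.
rewrite /bisum [X in _ + X]big_nil addr0 => ->.
by ring.
Qed.

Lemma bailey_chain_pair (m B a b : nat) (alpha : int -> K) (kappa : int -> int)
    (f : nat -> K) :
    (forall n, (n < B)%N -> f n = bisum (fun k => alpha k *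
       (w (n%:Z - kappa k) * w (n%:Z + kappa k + e%:Z))) a b) ->
  forall L, (L < B)%N ->
  iter m (bailey_step B) f L =
  bisum (fun k => (p ^ (kappa k * kappa k + e%:Z * kappa k)) ^+ m * alpha k *
       (w (L%:Z - kappa k) * w (L%:Z + kappa k + e%:Z))) a b.
Proof.
move=> fE; elim: m => [|m IHm] L LB.
  by rewrite /= fE //; apply: eq_bisum => k; rewrite expr0 mul1r.
rewrite iterS (bailey_step_pair IHm) //; apply: eq_bisum => k.
by rewrite exprS; ring.
Qed.

(* The sum of [x_i ^ 2 + e x_i] over the suffix sums [x_i = v_i + v_(i+1) + ... + j]. *)
Fixpoint chain_exponent (v : seq nat) (j : nat) : nat :=
  if v is a :: v' then
    let x := (a + (sumn v' + j))%N in (x * x + e * x + chain_exponent v' j)%N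
  else 0.

(** Taking the suffix sum x = a + sumn v + j as variable instead of the first entry a makes the
    outer sum one [bailey_step]; [w a%:Z] turns into the cutoff of the shorter chain at x. *)
Lemma bailey_chain_sum (k B L : nat) (W : nat -> K) : (L < B)%N ->
  \sum_(v <- words k B) \sum_(0 <= j < B)
    p ^+ chain_exponent v j * w (L%:Z - (sumn v + j)%N%:Z) *
    (\prod_(a <- v) w a%:Z) * W j =
  iter k (bailey_step B) (fun n => \sum_(0 <= j < B) w (n%:Z - j%:Z) * W j) L.
Proof.
elim: k L => [|k IHk] L LB.
  by rewrite big_seq1; apply: eq_bigr => j _; rewrite big_nil expr0 mul1r mulr1.
rewrite big_words_cons exchange_big /=.
transitivity (\sum_(v <- words k B) \sum_(0 <= j < B) \sum_(0 <= x < B)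
   p ^+ (x * x + e * x) * w (L%:Z - x%:Z) * (p ^+ chain_exponent v j *
    w (x%:Z - (sumn v + j)%N%:Z) * (\prod_(a <- v) w a%:Z) * W j)).
  apply: eq_bigr => v _; rewrite exchange_big; apply: eq_bigr => j _ /=.
  pose H x := p ^+ (x * x + e * x) * w (L%:Z - x%:Z) * (p ^+ chain_exponent v j *
    w (x%:Z - (sumn v + j)%N%:Z) * (\prod_(a <- v) w a%:Z) * W j).
  rewrite -[RHS](@big_nat_shift _ H B (sumn v + j)) /H; first last.
  - by move=> x Bx; rewrite [w (L%:Z - _)]iqfact_neg ?mulr0 ?mul0r //; lia.
  - by move=> x xv; rewrite [w (x%:Z - _)]iqfact_neg ?mulr0 ?mul0r ?mulr0 //; lia.
  apply: eq_bigr => a _; rewrite big_cons exprD.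
  have -> : (a + (sumn v + j))%N%:Z - (sumn v + j)%N%:Z = a%:Z by lia.
  by rewrite /= addnA; ring.
rewrite /bailey_step.
under eq_bigr do rewrite exchange_big /=.
rewrite exchange_big /=; apply: eq_big_nat => x xB.
rewrite -IHk // mulr_sumr; apply: eq_bigr => v _.
by rewrite mulr_sumr.
Qed.

End BaileyChain.

(** * The finite form of the identity, split by the parity of M *)

Lemma size_words k B v : v \in words k B -> size v = k.
Proof.
elim: k v => [|k IHk] v /=; first by rewrite inE => /eqP->.
by case/allpairsPdep => x [l [_ /IHk <- ->]].
Qed.

Lemma big_nat_double (V : nmodType) (G : nat -> V) B :
  \sum_(0 <= m < B.*2) G m =
  \sum_(0 <= j < B) G j.*2 + \sum_(0 <= j < B) G j.*2.+1.
Proof.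
elim: B => [|B IHB]; first by rewrite !big_nil addr0.
by rewrite doubleS !big_nat_recr //= IHB -addrA addrACA.
Qed.

Lemma qpoch_add (K : numFieldType) (a x : K) m n :
  qpoch a x (m + n) = qpoch a x m * qpoch (a * x ^+ m) x n.
Proof.
rewrite /qpoch big_split_ord /=; congr (_ * _); apply: eq_bigr => i _.
by rewrite exprD mulrA.
Qed.

Lemma qpoch_parity (K : numFieldType) (a x : K) n :
  qpoch a x n.*2 = qpoch a (x ^+ 2) n * qpoch (a * x) (x ^+ 2) n.
Proof.
elim: n => [|n IHn]; first by rewrite !qpoch0 mulr1.
have e : x ^+ n.*2 = x ^+ 2 ^+ n by rewrite -mul2n exprM.
by rewrite doubleS !qpochS IHn [x ^+ n.*2.+1]exprS e; ring.
Qed.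

Lemma qpoch_double (K : numFieldType) (q : K) n :
  qpoch q q n.*2 = qpoch q (q ^+ 2) n * qpoch (q ^+ 2) (q ^+ 2) n.
Proof. by rewrite qpoch_parity expr2. Qed.

Lemma qpoch_doubleS (K : numFieldType) (q : K) n :
  qpoch q q n.*2.+1 = qpoch q (q ^+ 2) n.+1 * qpoch (q ^+ 2) (q ^+ 2) n.
Proof. by rewrite qpochS qpoch_double [in RHS]qpochS -exprM mul2n; ring. Qed.

Lemma qpochN (K : numFieldType) (a x : K) n :
  qpoch (- a) x n * qpoch a x n = qpoch (a ^+ 2) (x ^+ 2) n.
Proof.
elim: n => [|n IHn]; first by rewrite !qpoch0 mulr1.
by rewrite !qpochS -IHn [x ^+ 2 ^+ n]exprAC; ring.
Qed.

Section FiniteIdentity.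
Variables (K : numFieldType) (s : K).
Hypothesis s0 : s != 0.
Local Notation q := (s ^+ 2).
Local Notation p := (q ^+ 2).
Hypothesis q1 : forall n, q ^+ n.+1 != 1.
Local Notation w := (iqfact p).

Let q0 : q != 0. Proof. by rewrite expf_neq0. Qed.

Let p0 : p != 0. Proof. by rewrite expf_neq0. Qed.

Let p1 n : p ^+ n.+1 != 1.
Proof. by rewrite -exprM mulnS; apply: q1. Qed.

Let qN1 n : q ^+ n.+1 != - 1.
Proof.
apply/eqP => qN; have /eqP[] := q1 (n.+1 + n).
by rewrite -addnS exprD qN mulrNN mulr1.
Qed.

Let u1 n : (- q) ^+ n.+1 != 1.
Proof.
apply/eqP => uN; have /eqP[] := p1 n.
by rewrite -[p]sqrrN exprAC uN expr1n.
Qed.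

Let uN1 n : (- q) ^+ n.+1 != - 1.
Proof.
apply/eqP => uN; have /eqP[] := p1 n.
by rewrite -[p]sqrrN exprAC uN sqrrN expr1n.
Qed.

(* A column vector is split as its first entry [n], its middle entries [v] and
   its last entry; the latter is [M] for the first summand of the theorem and
   [M - 1] for the second one.  The parity of [M] selects the Bailey pair. *)
Definition euler_term (A n M : nat) : K :=
  q ^+ (n * n + n * M) * w n%:Z * (qpoch p p A * w (A%:Z - n%:Z)).

Lemma sum_euler_term (A B M : nat) : (A < B)%N ->
  \sum_(0 <= n < B) euler_term A n M = qpoch (- q ^+ M.+1) p A.
Proof.
move=> AB.
have qM0 : q ^+ M.+1 != 0 by rewrite expf_neq0.
have := qbinomial_bilateral p0 p1 qM0 AB (leqnn 0).
rewrite qpoch0 addn0 /bisum [X in _ + X]big_nil addr0 mulr1 => H.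
rewrite -[RHS](mulfK (qfact_neq0 p1 A)) [RHS]mulrAC -[RHS]mulrA.
rewrite [X in _ * X]mulrC -iqfactE mulrCA -H mulr_sumr; apply: eq_bigr => n _.
rewrite /euler_term add0r -exprnP.
have -> : q ^+ (n * n + n * M) = p ^+ tri n%:Z * q ^+ M.+1 ^+ n.
  by rewrite -!exprM -exprD; congr (_ ^+ _); have := triE n; nia.
by ring.
Qed.

(** For odd M the square to be summed is (x + 1/2)^2 = x^2 + x + 1/4, and each quarter contributes
    p^(1/4) = s. The last factor is a cutoff that tends to 1 as L grows. *)
Definition chain_term (L : nat) (v : seq nat) (M : nat) : K :=
  p ^+ chain_exponent (odd M) v M./2 * s ^+ (odd M * size v) *
  (\prod_(a <- v) w a%:Z) *
  (qpoch p p L * w (L%:Z - (sumn v + M./2)%N%:Z)).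

(* The term 1 comes from the first summand, the term (1 - q^M) / p from the
   second one, where 1 / (q; q)_(M - 1) = (1 - q^M) / (q; q)_M. *)
Definition last_term (M : nat) : K :=
  s ^+ (M * M + 2 * M) * (1 + (1 - q ^+ M) / p) / qpoch q q M.

Definition even_side (m L : nat) : K :=
  qpoch p p L * qpoch (- q) p L *
  bisum (fun k => (p ^ ((k + k) * (k + k))) ^+ m * ((-1) ^ k * p ^+ (6 * tri k)) *
    (w (L%:Z - k - k) * w (L%:Z + k + k))) L.+1 L.

(** The prefactor collects one s for each of m - 1 middle entries and s^3 / p from [odd_last]. *)
Definition odd_side (m L : nat) : K :=
  s ^+ m.+2 / p * (qpoch p p L * qpoch (- p) p L) *
  bisum (fun k => (p ^ (k * k + k)) ^+ m * ((-1) ^ k * (- q) ^+ (3 * tri k)) *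
    (w (L%:Z - k) * w (L%:Z + k + 1))) L.+1 L.+1.

(** With the cutoff A = L - j, the factor (- q; p)_j completes Euler's product to (- q; p)_L, which
    is free of j. What remains is the weight of a Bailey step times the seed of
    [even_bailey_pair]. *)
Let even_last (L j : nat) : (j <= L)%N ->
  qpoch (- q ^+ j.*2.+1) p (L - j) * last_term j.*2 =
  qpoch (- q) p L * (p ^+ (j * j + 0 * j) *
   (p ^+ j * (1 + p^-1 - p ^+ j / p) / (qpoch p (p ^+ 2) j * qpoch p p j))).
Proof.
move=> jL; rewrite -{2}(subnKC jL) qpoch_add /last_term qpoch_double.
have -> : - q * p ^+ j = - q ^+ j.*2.+1 by rewrite mulNr -exprM -exprS mul2n.
have -> : qpoch p (p ^+ 2) j = qpoch (- q) p j * qpoch q p j by rewrite qpochN.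
have := qfact_neq0 p1 j; have := qfact_neq0 q1 j.*2; rewrite qpoch_double.
rewrite mulf_eq0 negb_or => /andP[h1 h2] _.
have : qpoch (- q) p j != 0.
  apply/prodf_neq0 => i _; rewrite mulNr opprK -exprM -exprS.
  by rewrite addrC -[1]opprK subr_eq0 qN1.
have -> : q ^+ j.*2 = p ^+ j by rewrite -mul2n exprM.
have -> : s ^+ (j.*2 * j.*2 + 2 * j.*2) = p ^+ (j * j) * p ^+ j.
  by rewrite -exprD -!exprM; congr (_ ^+ _); nia.
rewrite mul0n addn0 => h3; field.
by rewrite h1 h2 h3 ?s0.
Qed.

(** As before, with (- p; p)_L. For M = 2 j + 1 one has M^2 + 2 M = 4 (j^2 + 2 j) + 3, which leaves
    s^3; the factor 1 / p comes from [last_term]. *)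
Let odd_last (L j : nat) : (j <= L)%N ->
  qpoch (- q ^+ j.*2.+2) p (L - j) * last_term j.*2.+1 =
  s ^+ 3 / p * qpoch (- p) p L * (p ^+ (j * j + 1 * j) *
   (p ^+ j * (1 + p - q * p ^+ j) /
     (qpoch q p j.+1 * qpoch (p ^+ 2) (p ^+ 2) j))).
Proof.
move=> jL; rewrite -{2}(subnKC jL) qpoch_add /last_term qpoch_doubleS -(qpochN p p).
have -> : - p * p ^+ j = - q ^+ j.*2.+2.
  by rewrite mulNr -exprS -!exprM; congr (- (_ ^+ _)); lia.
have := qfact_neq0 p1 j; have := qfact_neq0 q1 j.*2.+1; rewrite qpoch_doubleS.
rewrite mulf_eq0 negb_or => /andP[h1 h2] _.
have : qpoch (- p) p j != 0.
  apply/prodf_neq0 => i _; rewrite mulNr opprK -exprS.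
  have -> : p ^+ i.+1 = q ^+ (2 * i).+2 by rewrite -!exprM; congr (_ ^+ _); lia.
  by rewrite addrC -[1]opprK subr_eq0 qN1.
have -> : q ^+ j.*2.+1 = q * p ^+ j by rewrite -!exprM -exprD; congr (_ ^+ _); lia.
have -> : s ^+ (j.*2.+1 * j.*2.+1 + 2 * j.*2.+1) = s ^+ 3 * p ^+ (j * j + 1 * j) * p ^+ j.
  by rewrite -!exprM -!exprD; congr (_ ^+ _); nia.
move=> h3; field.
by rewrite h1 h2 h3 ?s0.
Qed.

Let even_chain (k L : nat) :
  \sum_(0 <= j < L.+1) \sum_(v <- words k L.+1)
    chain_term L v j.*2 * (qpoch (- q ^+ j.*2.+1) p (L - j) * last_term j.*2) =
  even_side k.+1 L.
Proof.
rewrite exchange_big /=.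
pose f j := p ^+ j * (1 + p^-1 - p ^+ j / p) / (qpoch p (p ^+ 2) j * qpoch p p j).
transitivity (qpoch p p L * qpoch (- q) p L *
   iter k.+1 (bailey_step p 0 L.+1) f L).
  (* The weight p^(j^2) of the last entry is the first step of the chain, so k middle entries yield
     k + 1 steps. *)
  have -> : iter k.+1 (bailey_step p 0 L.+1) f L = iter k (bailey_step p 0 L.+1)
      (fun n => \sum_(0 <= j < L.+1) w (n%:Z - j%:Z) * (p ^+ (j * j + 0 * j) * f j)) L.
    rewrite iterSr; congr (iter _ _ _ _); apply/funext => n.
    by apply: eq_bigr => j _; ring.
  rewrite -bailey_chain_sum // mulr_sumr.
  apply: eq_bigr => v _; rewrite mulr_sumr; apply: eq_big_nat => j jL.
  rewrite even_last // /chain_term odd_double doubleK expr0.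
  by rewrite -/(f j) /=; move: (f j) => fj; ring.
rewrite (@bailey_chain_pair _ _ p0 p1 0 (leqnSn 0) k.+1 L.+1 L.+1 L
  (fun k => (-1) ^ k * p ^+ (6 * tri k)) (fun k => k + k)) //.
  congr (_ * _); apply: eq_bisum => i.
  by rewrite mul0r !addr0 addrA opprD addrA.
move=> n nL; rewrite /f -(even_bailey_pair p0 p1 (nL : (n <= L)%N)); apply: eq_bisum => i.
by rewrite addr0 addrA opprD addrA.
Qed.

Let odd_chain (k L : nat) :
  \sum_(0 <= j < L.+1) \sum_(v <- words k L.+1)
    chain_term L v j.*2.+1 *
    (qpoch (- q ^+ j.*2.+2) p (L - j) * last_term j.*2.+1) =
  odd_side k.+1 L.
Proof.
rewrite exchange_big /=.
pose f j := p ^+ j * (1 + p - q * p ^+ j) /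
     (qpoch q p j.+1 * qpoch (p ^+ 2) (p ^+ 2) j).
transitivity (s ^+ k.+3 / p * (qpoch p p L * qpoch (- p) p L) *
   iter k.+1 (bailey_step p 1 L.+1) f L).
  have -> : iter k.+1 (bailey_step p 1 L.+1) f L = iter k (bailey_step p 1 L.+1)
      (fun n => \sum_(0 <= j < L.+1) w (n%:Z - j%:Z) * (p ^+ (j * j + 1 * j) * f j)) L.
    rewrite iterSr; congr (iter _ _ _ _); apply/funext => n.
    by apply: eq_bigr => j _; ring.
  rewrite -bailey_chain_sum // mulr_sumr.
  apply: eq_big_seq => v vk; rewrite mulr_sumr; apply: eq_big_nat => j jL.
  rewrite odd_last // /chain_term /= odd_double uphalf_double.
  rewrite (size_words vk) (mul1n k).
  have -> : s ^+ k.+3 = s ^+ k * s ^+ 3 by rewrite -exprD addn3.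
  by rewrite -/(f j) /=; move: (f j) => fj; ring.
rewrite (@bailey_chain_pair _ _ p0 p1 1 (leqnn 1) k.+1 L.+1 L.+1 L.+1
  (fun k => (-1) ^ k * (- q) ^+ (3 * tri k)) id) //.
  by congr (_ * _); apply: eq_bisum => i; rewrite mul1r.
move=> n nL.
have u0 : - q != 0 by rewrite oppr_eq0.
have := odd_bailey_pair u0 u1 uN1 (n := n) (L := L) nL.
have -> : (- q) ^+ 4 = p ^+ 2 by ring.
by rewrite sqrrN opprK mulNr => ->.
Qed.

(** Euler's sum over n is carried out first, then even and odd M are separated. The range of M is
    the one in which M / 2, rounded down, is at most L. *)
Lemma finite_identity (k L : nat) :
  \sum_(0 <= n < L.+1) \sum_(v <- words k L.+1) \sum_(0 <= M < L.+1.*2)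
    euler_term (L - M./2) n M * chain_term L v M * last_term M =
  even_side k.+1 L + odd_side k.+1 L.
Proof.
rewrite -even_chain -odd_chain.
transitivity (\sum_(0 <= M < L.+1.*2) \sum_(v <- words k L.+1)
    chain_term L v M * (qpoch (- q ^+ M.+1) p (L - M./2) * last_term M)).
  rewrite exchange_big [RHS]exchange_big /=; apply: eq_bigr => v _.
  rewrite exchange_big /=; apply: eq_bigr => M _.
  rewrite -(@sum_euler_term _ L.+1) ?ltnS ?leq_subr // mulrCA mulr_suml.
  by apply: eq_bigr => n _; rewrite mulrA.
rewrite big_nat_double; congr (_ + _); apply: eq_bigr => j _; apply: eq_bigr => v _.
  by rewrite doubleK.
by rewrite /= uphalf_double.
Qed.

End FiniteIdentity.

(** * Dominated convergence *)

Section Tannery.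
Local Open Scope classical_set_scope.
Variables (K : numFieldType).

Lemma ler_sum_uniq_subset (I : eqType) (A B : seq I) (g : I -> K) :
    uniq A -> uniq B -> {subset A <= B} -> (forall i, 0 <= g i) ->
  \sum_(i <- A) g i <= \sum_(i <- B) g i.
Proof.
move=> uA uB AB g0; rewrite [leRHS](bigID (mem A)) /=.
have pA : perm_eq [seq i <- B | i \in A] A.
  apply: uniq_perm; rewrite ?filter_uniq // => i.
  by rewrite mem_filter; case: (boolP (i \in A)) => //= /AB ->.
by rewrite -[X in _ <= X + _]big_filter (perm_big _ pA) lerDl sumr_ge0.
Qed.

Lemma near_subset (I : eqType) (D : nat -> seq I) (A : seq I) :
    (forall i, \forall L \near \oo, i \in D L) ->
  \forall L \near \oo, {subset A <= D L}.
Proof.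
move=> Di; elim: A => [|i A IHA]; first by near=> L => j.
near=> L => j; rewrite inE => /orP[/eqP->|jA]; first by near: L.
by move: j jA; near: L.
Unshelve. all: by end_near. Qed.

(** Summability of a nonnegative family expressed by finite sets only, so that no sum has to exist
    in [K]. *)
Definition small_tails (I : eqType) (g : I -> K) : Prop :=
  forall e : K, 0 < e -> exists A : seq I, forall B : seq I,
    uniq B -> {in B, forall i, i \notin A} -> \sum_(i <- B) g i <= e.

Lemma small_tailsZ (I : eqType) (c : K) (g : I -> K) :
  0 <= c -> small_tails g -> small_tails (fun i => c * g i).
Proof.
(* Dividing by c + 1 covers the case c = 0. *)
move=> c0 tg e e0; have c1 : 0 < c + 1 by rewrite ltr_wpDl.
have [A HA] := tg (e / (c + 1)) (divr_gt0 e0 c1).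
exists A => B uB BA; rewrite -mulr_sumr.
apply: le_trans (ler_wpM2l c0 (HA B uB BA)) _.
have c_le1 : c / (c + 1) <= 1 by rewrite ler_pdivrMr // mul1r lerDl.
by rewrite mulrCA ler_piMr // ltW.
Qed.

Lemma small_tails_exhaustion (I : eqType) (g : I -> K) (E : nat -> seq I) (G : K) :
    (forall i, 0 <= g i) -> (forall N, uniq (E N)) ->
    (forall i, \forall N \near \oo, i \in E N) ->
    (forall N, \sum_(i <- E N) g i <= G) ->
    \sum_(i <- E N) g i @[N --> \oo] --> G ->
  small_tails g.
Proof.
move=> g0 uE Ei EG cG e e0.
have /cvgrPdist_lt /(_ e e0) [N _ /(_ N (leqnn N)) GN] := cG.
exists (E N) => B uB BE.
have [N' _ /(_ N' (leqnn N')) /= sub] := near_subset (B ++ E N) Ei.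
have u : uniq (B ++ E N).
  rewrite cat_uniq uB uE andbT; apply/hasPn => i iE.
  by apply/negP => /BE; rewrite iE.
have := le_trans (ler_sum_uniq_subset u (uE N') sub g0) (EG N').
rewrite big_cat /= -lerBrDr => h; apply: le_trans h _.
by rewrite ltW // (le_lt_trans _ GN) // ger0_norm // subr_ge0.
Qed.

(** The tail of [g] controls the indices off a finite set A; on A there are finitely many null
    sequences, whatever part of A lies in [D L]. *)
Lemma tannery0 (I : eqType) (g : I -> K) (h : nat -> I -> K) (D : nat -> seq I) :
    (forall i, 0 <= g i) -> small_tails g -> (forall L, uniq (D L)) ->
    (forall L i, `|h L i| <= g i) ->
    (forall i, h L i @[L --> \oo] --> (0 : K)) ->
  \sum_(i <- D L) h L i @[L --> \oo] --> (0 : K).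
Proof.
move=> g0 tg uD hg h0; apply/cvgr0Pnorm_le => e e0.
have e2 : 0 < e / 2 by rewrite divr_gt0.
have [A HA] := tg _ e2.
have cA : \sum_(i <- undup A) `|h L i| @[L --> \oo] --> (0 : K).
  elim: (undup A) => [|i s IHs].
    by under eq_fun do rewrite big_nil; apply: cvg_cst.
  under eq_fun do rewrite big_cons.
  have hi : `|h L i| @[L --> \oo] --> (0 : K).
    by apply/norm_cvg0P; apply: h0.
  by have := cvgD hi IHs; rewrite addr0; apply.
near=> L; apply: le_trans (ler_norm_sum _ _ _) _.
rewrite (bigID (mem A)) /= [e]splitr lerD //.
  rewrite -big_filter.
  apply: (@le_trans _ _ (\sum_(i <- undup A) `|h L i|)).
    apply: ler_sum_uniq_subset; rewrite ?filter_uniq ?undup_uniq // => i.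
    by rewrite mem_filter mem_undup => /andP[].
  rewrite -[leLHS]ger0_norm ?sumr_ge0 //.
  by near: L; apply: cvgr0_norm_le.
rewrite -big_filter; apply: (@le_trans _ _ (\sum_(i <- D L | i \notin A) g i)).
  by rewrite big_filter; apply: ler_sum.
rewrite -big_filter; apply: HA; first by rewrite filter_uniq.
by move=> i; rewrite mem_filter => /andP[].
Unshelve. all: by end_near. Qed.

(* Dominated convergence for sums over an exhausting sequence of finite sets;
   the limit of the truncated sums is given, so that no completeness is used. *)
Lemma tannery_has_sum (I : choiceType) (g : I -> K) (f : I -> K)
    (fL : nat -> I -> K) (D : nat -> seq I) (s : K) :
    (forall i, 0 <= g i) -> small_tails g -> (forall L, uniq (D L)) ->
    (forall i, \forall L \near \oo, i \in D L) ->
    (forall L i, `|fL L i| <= g i) ->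
    (forall i, fL L i @[L --> \oo] --> f i) ->
    \sum_(i <- D L) fL L i @[L --> \oo] --> s ->
  has_sum f s.
Proof.
have PF := @totally_filter I.
move=> g0 tg uD Di fg ff Ss; apply/cvgrPdist_le => e e0.
have e3 : 0 < e / 3 by rewrite divr_gt0.
have [A0 HA0] := tg _ e3.
exists (seq_fset tt A0) => // A /= A0A.
have -> : partial_sum f A = \sum_(i <- enum_fset A) f i.
  by rewrite /partial_sum big_seq_fsetE.
have cA : \sum_(i <- enum_fset A) fL L i @[L --> \oo] --> \sum_(i <- enum_fset A) f i.
  elim: (enum_fset A) => [|i t IHt].
    by under eq_fun do rewrite big_nil; rewrite big_nil; apply: cvg_cst.
  by under eq_fun do rewrite big_cons; rewrite big_cons; apply: cvgD.
(* A single L serves all three estimates. The truncated sums over [D L] and over A then differ only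
   off A, where the tail of [g] is small. *)
have [L _ /(_ L (leqnn L)) [[h1 h2] h3]] : \forall L \near \oo,
   (`|s - \sum_(i <- D L) fL L i| <= e / 3 /\
    `|\sum_(i <- enum_fset A) f i - \sum_(i <- enum_fset A) fL L i| <= e / 3) /\
    {subset enum_fset A <= D L}.
  near=> L; split; last by near: L; apply: near_subset.
  by split; near: L; [move/cvgrPdist_le: Ss; apply|move/cvgrPdist_le: cA; apply].
have -> : s - \sum_(i <- enum_fset A) f i =
  (s - \sum_(i <- D L) fL L i) +
  (\sum_(i <- D L) fL L i - \sum_(i <- enum_fset A) fL L i) -
  (\sum_(i <- enum_fset A) f i - \sum_(i <- enum_fset A) fL L i) by ring.
have -> : e = e / 3 + e / 3 + e / 3 by field.
apply: le_trans (ler_normB _ _) _; rewrite lerD //.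
apply: le_trans (ler_normD _ _) _; rewrite lerD //.
have pA : perm_eq [seq i <- D L | i \in A] (enum_fset A).
  apply: uniq_perm; rewrite ?filter_uniq ?fset_uniq // => i.
  by rewrite mem_filter; case: (boolP (i \in A)) => //= /h3 ->.
rewrite (bigID (mem A)) /= -[X in `|X + _ - _|]big_filter (perm_big _ pA) /=.
rewrite addrAC subrr add0r -big_filter; apply: le_trans (ler_norm_sum _ _ _) _.
apply: (@le_trans _ _ (\sum_(i <- [seq i <- D L | i \notin A]) g i)).
  exact: ler_sum.
apply: HA0; first by rewrite filter_uniq.
move=> i; rewrite mem_filter => /andP[iA _]; apply: contra iA => iA0.
by have iA0s := seq_fsetE tt A0 i; rewrite iA0 in iA0s; apply: (fsubsetP A0A).
Unshelve. all: by end_near. Qed.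

End Tannery.

(** * Geometric series and their powers as sums over column vectors *)

Section SequenceFacts.
Local Open Scope classical_set_scope.
Variables (K : numFieldType).

Lemma cvgn_bounded (u : nat -> K) : cvgn u ->
  exists2 C : K, 0 < C & forall n, `|u n| <= C.
Proof.
move=> /cvg_seq_bounded; rewrite /bounded_fun /bounded_near.
move=> /pinfty_ex_gt0 [C C0 uC]; exists C => // n.
by apply: uC.
Qed.

Lemma cvgn_exp (u : nat -> K) (l : K) r :
  u n @[n --> \oo] --> l -> u n ^+ r @[n --> \oo] --> l ^+ r.
Proof.
move=> ul; elim: r => [|r IHr]; first by under eq_fun do rewrite expr0; apply: cvg_cst.
by under eq_fun do rewrite exprS; rewrite exprS; apply: cvgM.
Qed.

(** A [numFieldType] may be neither archimedean nor complete; this and the convergence of [qpoch]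
    are proved later for the complex field. *)
Hypothesis geometric_cvg0 :
  forall x : K, `|x| < 1 -> x ^+ n @[n --> \oo] --> (0 : K).

Lemma geometric_sumE (x : K) N : x != 1 ->
  \sum_(0 <= i < N) x ^+ i = (1 - x ^+ N) / (1 - x).
Proof.
move=> x1; have d0 : 1 - x != 0 by rewrite subr_eq0 eq_sym.
apply: (mulfI d0); rewrite mulrCA mulfV // mulr1 big_mkord.
by rewrite -opprB mulNr -subrX1 opprB.
Qed.

Lemma geometric_sum_cvg (x : K) : `|x| < 1 ->
  \sum_(0 <= i < N) x ^+ i @[N --> \oo] --> (1 - x)^-1.
Proof.
move=> x1; have xn1 : x != 1 by apply: contraTneq x1 => ->; rewrite normr1 ltxx.
under eq_fun do rewrite geometric_sumE //.
have := cvgMr_tmp (b := (1 - x)^-1) (cvgB (cvg_cst (1 : K)) (geometric_cvg0 x1)).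
by rewrite subr0 mul1r; apply.
Qed.

Lemma geometric_sum_le (x : K) N : 0 <= x -> x < 1 ->
  \sum_(0 <= i < N) x ^+ i <= (1 - x)^-1.
Proof.
move=> x0 x1; have d0 : 0 <= (1 - x)^-1 by rewrite invr_ge0 subr_ge0 ltW.
have xN : 1 - x ^+ N <= 1 by rewrite gerBl exprn_ge0.
by rewrite geometric_sumE ?lt_eqF // ler_piMl.
Qed.

Lemma geometric_tails (x : K) : 0 <= x -> x < 1 ->
  small_tails (fun i : nat => x ^+ i).
Proof.
move=> x0 x1.
have iotaE N : \sum_(i <- iota 0 N) x ^+ i = \sum_(0 <= i < N) x ^+ i.
  by rewrite /index_iota subn0.
apply: (@small_tails_exhaustion _ _ _ (iota 0) (1 - x)^-1).
- by move=> i; apply: exprn_ge0.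
- exact: iota_uniq.
- by move=> i; exists i.+1 => // N /=; rewrite mem_iota.
- by move=> N; rewrite iotaE geometric_sum_le.
- under eq_fun do rewrite iotaE.
  by apply: geometric_sum_cvg; rewrite ger0_norm.
Qed.

Lemma mem_words k B l : (l \in words k B) = (size l == k) && all (fun x => x < B)%N l.
Proof.
elim: k l => [|k IHk] [|x l] //=.
- by apply/negbTE/negP => /allpairsPdep[y [l [_ _]]].
- apply/allpairsPdep/and3P => [[y [l' [yB l'B [-> ->]]]]|[sl xB lB]].
    move: l'B yB; rewrite IHk mem_iota /= add0n => /andP[/eqP-> ->] ->.
    by rewrite eqxx.
  by exists x, l; rewrite mem_iota IHk; split=> //; rewrite -eqSS sl.
Qed.

Lemma words_uniq k B : uniq (words k B).
Proof.
elim: k => //= k IHk; apply: allpairs_uniq => //; first exact: iota_uniq.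
by move=> [x l] [y l'] _ _ /= [-> ->].
Qed.

Lemma sum_words_geometric (x : K) k B :
  \sum_(l <- words k B) \prod_(a <- l) x ^+ a = (\sum_(0 <= i < B) x ^+ i) ^+ k.
Proof.
elim: k => [|k IHk]; first by rewrite big_seq1 big_nil expr0.
rewrite big_words_cons exprS mulr_suml; apply: eq_bigr => a _.
by rewrite -IHk mulr_sumr; apply: eq_bigr => l _; rewrite big_cons.
Qed.

Definition seq_of_col r (n : 'cV[nat]_r) : seq nat :=
  [seq n i 0 | i <- enum 'I_r].

Definition col_of_seq r (l : seq nat) : 'cV[nat]_r := \col_i nth 0%N l i.

Lemma size_seq_of_col r (n : 'cV[nat]_r) : size (seq_of_col n) = r.
Proof. by rewrite size_map size_enum_ord. Qed.

Lemma seq_of_colK r : cancel (@seq_of_col r) (@col_of_seq r).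
Proof.
move=> n; apply/colP => i; rewrite mxE (nth_map i) ?size_enum_ord //.
by rewrite nth_ord_enum.
Qed.

Lemma col_of_seqK r l : size l = r -> seq_of_col (col_of_seq r l) = l.
Proof.
move=> sl; apply: (@eq_from_nth _ 0%N); rewrite size_seq_of_col // => i ir.
rewrite (nth_map (Ordinal ir)) ?size_enum_ord // mxE.
by rewrite (nth_enum_ord (Ordinal ir)).
Qed.

Lemma col_of_seq_inj r (l l' : seq nat) : size l = r -> size l' = r ->
  col_of_seq r l = col_of_seq r l' -> l = l'.
Proof. by move=> /col_of_seqK {2}<- /col_of_seqK {2}<- ->. Qed.

Lemma near_all_lt (l : seq nat) : \forall N \near \oo, all (fun x => x < N)%N l.
Proof.
exists (sumn l).+1 => // N /= lN; apply/allP => x xl.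
apply: leq_ltn_trans lN; elim: l xl => //= a l IHl.
by rewrite inE => /orP[/eqP->|/IHl]; [rewrite leq_addr|move/leq_trans->; rewrite ?leq_addl].
Qed.

(** The sum over the box [0, N)^r is the r-th power of a geometric sum, and these boxes exhaust the
    columns. *)
Lemma geometric_tails_col (x : K) r : 0 <= x -> x < 1 ->
  small_tails (fun n : 'cV[nat]_r => \prod_(a <- seq_of_col n) x ^+ a).
Proof.
move=> x0 x1.
have sumE N : \sum_(n <- [seq col_of_seq r l | l <- words r N])
    \prod_(a <- seq_of_col n) x ^+ a = (\sum_(0 <= i < N) x ^+ i) ^+ r.
  rewrite big_map -sum_words_geometric !big_seq; apply: eq_bigr => l.
  by rewrite mem_words => /andP[/eqP sl _]; rewrite col_of_seqK.
apply: (@small_tails_exhaustion _ _ _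
   (fun N => [seq col_of_seq r l | l <- words r N]) ((1 - x)^-1 ^+ r)).
- by move=> n; apply: prodr_ge0 => a _; apply: exprn_ge0.
- move=> N; rewrite map_inj_in_uniq ?words_uniq // => l l'.
  rewrite !mem_words => /andP[/eqP sl _] /andP[/eqP sl' _].
  exact: col_of_seq_inj.
- move=> n; have := near_all_lt (seq_of_col n); apply: filterS => N nN.
  apply/mapP; exists (seq_of_col n); last by rewrite seq_of_colK.
  by rewrite mem_words size_seq_of_col eqxx.
- move=> N; rewrite sumE lerXn2r ?nnegrE ?invr_ge0 ?subr_ge0 ?(ltW x1) //.
    by apply: sumr_ge0 => i _; apply: exprn_ge0.
  exact: geometric_sum_le.
- under eq_fun do rewrite sumE.
  by apply: cvgn_exp; apply: geometric_sum_cvg; rewrite ger0_norm.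
Qed.

End SequenceFacts.

(** * Infinite products and theta series *)

Section InfiniteProducts.
Local Open Scope classical_set_scope.
Variables (K : numFieldType).
Hypothesis geometric_cvg0 :
  forall x : K, `|x| < 1 -> x ^+ n @[n --> \oo] --> (0 : K).
Hypothesis qpoch_is_cvg :
  forall a x : K, `|x| < 1 -> cvgn (fun n => qpoch a x n).

Lemma expr_neq1 (x : K) : `|x| < 1 -> forall n, x ^+ n.+1 != 1.
Proof.
move=> x1 n; apply: contraTneq x1 => xn1.
by rewrite -(@expr_lt1 _ n.+1) // -normrX xn1 normr1 ltxx.
Qed.

Lemma cvg_qpoch (a x : K) : `|x| < 1 ->
  qpoch a x n @[n --> \oo] --> qpoch_inf a x.
Proof. by move=> x1; rewrite /qpoch_inf; exact: qpoch_is_cvg. Qed.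

(** Weierstrass's product inequality, through |1 - a x^k| >= 1 - |a| |x|^k. *)
Lemma qpoch_lower_bound (a x : K) n :
    \sum_(0 <= k < n) `|a| * `|x| ^+ k <= 1 ->
  1 - \sum_(0 <= k < n) `|a| * `|x| ^+ k <= `|qpoch a x n|.
Proof.
elim: n => [|n IHn]; first by rewrite big_nil subr0 qpoch0 normr1.
rewrite big_nat_recr //= qpochS normrM; set S := \sum_(_ <= _ < _) _.
set b := _ * _ => Sb.
have b0 : 0 <= b by rewrite mulr_ge0 ?exprn_ge0.
have S0 : 0 <= S by apply: sumr_ge0 => k _; rewrite mulr_ge0 ?exprn_ge0.
have S1 : S <= 1 by apply: le_trans Sb; rewrite lerDl.
have b1 : b <= 1 by apply: le_trans Sb; rewrite lerDr.
apply: (@le_trans _ _ ((1 - S) * (1 - b))).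
  have -> : (1 - S) * (1 - b) = 1 - (S + b) + S * b by ring.
  by rewrite lerDl mulr_ge0.
apply: ler_pM; rewrite ?subr_ge0 //; first exact: IHn.
by apply: le_trans (lerB_dist _ _); rewrite normr1 normrM normrX.
Qed.

(** From some N on the tail products have norm at least 1/2, which keeps the partial products away
    from 0 by half the norm of the nonzero N-th one. *)
Lemma qpoch_inf_neq0 (a x : K) : `|x| < 1 -> (forall k, a * x ^+ k != 1) ->
  qpoch_inf a x != 0.
Proof.
move=> x1 ax1; have d0 : 0 < 1 - `|x| by rewrite subr_gt0.
have nx1 : `| `|x| | < 1 by rewrite normr_id.
have e0 : 0 < (1 - `|x|) / 2 by rewrite divr_gt0.
have h : `|a| * `|x| ^+ n @[n --> \oo] --> (0 : K).
  by have := cvgMl_tmp (a := `|a|) (geometric_cvg0 nx1); rewrite mulr0; apply.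
have /cvgr0_norm_le /(_ _ e0) [N _ /(_ N (leqnn N)) /= hN] := h.
have aN : `|a * x ^+ N| <= (1 - `|x|) / 2.
  by rewrite normrM normrX -[leLHS]ger0_norm // mulr_ge0 ?exprn_ge0.
have low n : 2^-1 <= `|qpoch (a * x ^+ N) x n|.
  have S2 : \sum_(0 <= k < n) `|a * x ^+ N| * `|x| ^+ k <= 2^-1.
    rewrite -mulr_sumr; apply: le_trans (ler_pM _ _ aN (geometric_sum_le n _ x1)) _ => //.
      by apply: sumr_ge0 => k _; rewrite exprn_ge0.
    by rewrite mulrAC mulfV ?mul1r // gt_eqF.
  have half1 : 2^-1 <= 1 :> K by rewrite invf_le1 // ler1n.
  apply: le_trans (qpoch_lower_bound (le_trans S2 half1)).
  by rewrite lerBrDr -lerBrDl; apply: le_trans S2 _; rewrite {2}[1]splitr mul1r addrK.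
have PN : 0 < `|qpoch a x N|.
  by rewrite normr_gt0; apply/prodf_neq0 => k _; rewrite subr_eq0 eq_sym ax1.
apply/eqP => q0; have := @cvg_qpoch a x x1; rewrite q0.
have e20 : 0 < `|qpoch a x N| / 2 by rewrite divr_gt0.
move=> /cvgr0_norm_lt /(_ _ e20) [M _ /(_ (N + M)%N (leq_addl _ _)) /=].
by rewrite qpoch_add normrM ltr_pM2l // => /(le_lt_trans (low M)); rewrite ltxx.
Qed.

Section Base.
Variable p : K.
Hypothesis p_lt1 : `|p| < 1.

Lemma qfact_inf_neq0 : qpoch_inf p p != 0.
Proof. by apply: qpoch_inf_neq0 => // k; rewrite -exprS expr_neq1. Qed.

Lemma cvg_iqfact (k : int) :
  iqfact p (L%:Z + k) @[L --> \oo] --> (qpoch_inf p p)^-1.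
Proof.
have c : iqfact p L%:Z @[L --> \oo] --> (qpoch_inf p p)^-1.
  exact: cvgV qfact_inf_neq0 (@cvg_qpoch p p p_lt1).
case: k => n.
  by rewrite -(cvg_shiftn n) in c; apply: c.
have e : (fun L => iqfact p ((L + n.+1)%N%:Z + Negz n)) = (fun L : nat => iqfact p L%:Z).
  by apply/funext => L; congr (iqfact p _); lia.
by rewrite -e in c; rewrite -(cvg_shiftn n.+1); apply: c.
Qed.

Lemma iqfact_bounded : exists2 C : K, 0 < C & forall z, `|iqfact p z| <= C.
Proof.
have c : cvgn (fun L : nat => iqfact p (L%:Z + 0)).
  by apply/cvg_ex; exists (qpoch_inf p p)^-1; apply: cvg_iqfact.
have [C C0 HC] := cvgn_bounded c; exists C => // -[n|n].
  by have := HC n; rewrite addr0.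
by rewrite /iqfact normr0 ltW.
Qed.

End Base.

(* Compare with the finite Jacobi triple product, whose coefficients of
   P^(tri k) (- z)^k also converge and are bounded. *)
Lemma cvg_theta (P z c : K) (C : K) (cL : nat -> int -> K) (e : nat) :
    P != 0 -> z != 0 -> `|P| < 1 -> `|z| < 1 -> `|P / z| < 1 ->
    (forall L k, `|cL L k| <= C) ->
    (forall k, cL L k @[L --> \oo] --> c) ->
  bisum (fun k => P ^+ tri k * (- z) ^ k * cL L k) L.+1 (L + e) @[L --> \oo] -->
  c * (qpoch_inf z P * qpoch_inf (P / z) P * qpoch_inf P P).
Proof.
move=> P0 z0 P1 z1 Pz1 cC cc.
have P1n := expr_neq1 P1.
have [D D0 wD] := iqfact_bounded P1.
(* [b] holds the coefficients of the finite triple product, with limit 1 / (P; P)_oo^2. The factor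
   [gam] scales this limit to [c], so [h] tends to 0 and [tannery0] applies. *)
pose b L k := iqfact P (L%:Z - k) * iqfact P (L%:Z + k).
pose gam := c * qpoch_inf P P ^+ 2.
pose h L k := cL L k - gam * b L k.
pose C' := C + `|gam| * (D * D).
have C0 : 0 <= C by apply: le_trans (cC 0%N 0).
have C'0 : 0 <= C' by rewrite addr_ge0 // !mulr_ge0 // ltW.
have hC L k : `|h L k| <= C'.
  apply: le_trans (ler_normB _ _) _; rewrite lerD // normrM ler_wpM2l //.
  by rewrite normrM ler_pM.
have h0 k : h L k @[L --> \oo] --> (0 : K).
  have := cvgB (cc k) (cvgMl_tmp (a := gam)
    (cvgM (cvg_iqfact P1 (- k)) (cvg_iqfact P1 k))).
  rewrite /gam -expr2 -mulrA -exprMn mulfV ?qfact_inf_neq0 // expr1n mulr1 subrr.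
  by apply.
have tails x : `|x| < 1 -> small_tails (fun i : nat => C' * `|x| ^+ i).
  by move=> x1; apply: small_tailsZ => //; apply: geometric_tails.
have geq0 x (i : nat) : 0 <= C' * `|x| ^+ i by rewrite mulr_ge0 ?exprn_ge0.
have iotaE (N : nat) (F : nat -> K) : \sum_(0 <= i < N) F i = \sum_(i <- iota 0 N) F i.
  by rewrite /index_iota subn0.
have pos : \sum_(0 <= k < L.+1) P ^+ tri k%:Z * (- z) ^ k%:Z * h L k%:Z
    @[L --> \oo] --> (0 : K).
  under eq_fun do rewrite iotaE.
  apply: (tannery0 (g := fun i => C' * `|z| ^+ i)) => // [|L|L i|i].
  - exact: tails.
  - exact: iota_uniq.
  - rewrite normrM mulrC ler_pM // normrM normrX -exprnP normrX normrN.
    by rewrite ler_piMl ?exprn_ge0 // exprn_ile1 // ltW.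
  - have := cvgMl_tmp (a := P ^+ tri i%:Z * (- z) ^ i%:Z) (h0 i%:Z).
    by rewrite mulr0; apply.
have neg : \sum_(0 <= k < L + e) P ^+ tri (- 1 - k%:Z) * (- z) ^ (- 1 - k%:Z) *
    h L (- 1 - k%:Z) @[L --> \oo] --> (0 : K).
  under eq_fun do rewrite iotaE.
  apply: (tannery0 (g := fun i => C' * `|P / z| ^+ i)) => // [|L|L i|i].
  - exact: tails.
  - exact: iota_uniq.
  - rewrite normrM mulrC ler_pM //.
    (* At k = - 1 - i the term is P^(tri i + i) (- P / z)^(i + 1), which is dominated by |P /
       z|^i. *)
    have -> : P ^+ tri (- 1 - i%:Z) * (- z) ^ (- 1 - i%:Z) =
        P ^+ (tri i + i) * ((- (P / z)) ^+ i * (- (P / z))).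
      have y0 : - z != 0 by rewrite oppr_eq0.
      have -> : - (P / z) = P / - z by rewrite invrN mulrN.
      move: (- z) y0 => y y0.
      rewrite exprnP triN1B mulr2n !expfzDr // expr_div_n exprD.
      rewrite -!invr_expz !expr1z -!exprnP; field.
      by rewrite y0 expf_neq0.
    move: (P / z) Pz1 => t t1; rewrite !normrM !normrX normrN mulrCA.
    rewrite ler_piMr ?exprn_ge0 // mulr_ile1 ?exprn_ge0 ?(ltW t1) //.
    by rewrite exprn_ile1 // ltW.
  - have := cvgMl_tmp (a := P ^+ tri (- 1 - i%:Z) * (- z) ^ (- 1 - i%:Z)) (h0 (- 1 - i%:Z)).
    by rewrite mulr0; apply.
have nz0 : - z != 0 by rewrite oppr_eq0.
have bE L : bisum (fun k => P ^+ tri k * (- z) ^ k * cL L k) L.+1 (L + e) =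
   bisum (fun k => P ^+ tri k * (- z) ^ k * h L k) L.+1 (L + e) +
   gam * (qpoch z P L * qpoch (P / z) P L * iqfact P (L%:Z + L%:Z)).
  have := qbinomial_bilateral P0 P1n nz0 (ltnSn L) (leq_addr e L).
  rewrite opprK invrN mulrN opprK PoszD => <-; rewrite -bisumZ -bisumD.
  by apply: eq_bisum => k; rewrite /h /b; ring.
under eq_fun do rewrite bE.
have cLL : iqfact P (L%:Z + L%:Z) @[L --> \oo] --> (qpoch_inf P P)^-1.
  have dbl : (L + L)%N @[L --> \oo] --> \oo.
    move=> A [N _ HA]; exists N => // n /= Nn; apply: HA => /=.
    by rewrite (leq_trans Nn) ?leq_addr.
  have cw : iqfact P L%:Z @[L --> \oo] --> (qpoch_inf P P)^-1.
    by have := cvg_iqfact P1 0; under eq_fun do rewrite addr0.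
  exact: (cvg_comp _ _ dbl cw).
have := cvgD (cvgD pos neg) (cvgMl_tmp (a := gam)
  (cvgM (cvgM (@cvg_qpoch z P P1) (@cvg_qpoch (P / z) P P1)) cLL)).
rewrite !add0r /gam.
have -> : c * qpoch_inf P P ^+ 2 * (qpoch_inf z P * qpoch_inf (P / z) P / qpoch_inf P P) =
  c * (qpoch_inf z P * qpoch_inf (P / z) P * qpoch_inf P P).
  by field; apply: qfact_inf_neq0.
by apply.
Qed.

End InfiniteProducts.

(** * Limits of the two theta sides *)

Lemma sqr_double_tri (k : int) : (k + k) * (k + k) = (tri k)%:Z *+ 8 + k *+ 4.
Proof. by have := triE k; lia. Qed.

Lemma sqr_tri (k : int) : k * k + k = (tri k)%:Z *+ 2 + k *+ 2.
Proof. by have := triE k; lia. Qed.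

Lemma mulr_exprz_eq (K : numFieldType) (x : K) (a b c d : int) : x != 0 ->
  a + b = c + d -> x ^ a * x ^ b = x ^ c * x ^ d.
Proof. by move=> x0 e; rewrite -!expfzDr // e. Qed.

Section Limits.
Local Open Scope classical_set_scope.
Variables (K : numFieldType).
Hypothesis geometric_cvg0 :
  forall x : K, `|x| < 1 -> x ^+ n @[n --> \oo] --> (0 : K).
Hypothesis qpoch_is_cvg :
  forall a x : K, `|x| < 1 -> cvgn (fun n => qpoch a x n).

Let cvg_qpoch' (a x : K) : `|x| < 1 -> qpoch a x n @[n --> \oo] --> qpoch_inf a x.
Proof. exact: cvg_qpoch. Qed.

Let cvgn_unique (u : nat -> K) (l l' : K) :
  u n @[n --> \oo] --> l -> u n @[n --> \oo] --> l' -> l = l'.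
Proof. by move=> ul ul'; apply: (cvg_unique _ ul ul'); exact: norm_hausdorff. Qed.

Lemma norm_expr_lt1 (x : K) n : `|x| < 1 -> `|x ^+ n.+1| < 1.
Proof. by move=> x1; rewrite normrX exprn_ilt1. Qed.

Lemma qpoch_inf_double (a x : K) : `|x| < 1 ->
  qpoch_inf a x = qpoch_inf a (x ^+ 2) * qpoch_inf (a * x) (x ^+ 2).
Proof.
move=> x1; have x21 := norm_expr_lt1 1 x1.
have dbl : n.*2 @[n --> \oo] --> \oo.
  move=> A [N _ HA]; exists N => // n /= Nn; apply: HA => /=.
  by rewrite (leq_trans Nn) // -addnn leq_addr.
have c1 : qpoch a x n.*2 @[n --> \oo] --> qpoch_inf a x.
  exact: (cvg_comp _ _ dbl (@cvg_qpoch' a x x1)).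
apply: (cvgn_unique c1); under eq_fun do rewrite qpoch_parity.
exact: cvgM (@cvg_qpoch' a _ x21) (@cvg_qpoch' (a * x) _ x21).
Qed.

Lemma qpoch_infN (a x : K) : `|x| < 1 ->
  qpoch_inf (- a) x * qpoch_inf a x = qpoch_inf (a ^+ 2) (x ^+ 2).
Proof.
move=> x1; have x21 := norm_expr_lt1 1 x1.
apply: (cvgn_unique _ (@cvg_qpoch' (a ^+ 2) _ x21)).
under eq_fun do rewrite -qpochN.
exact: cvgM (@cvg_qpoch' (- a) _ x1) (@cvg_qpoch' a _ x1).
Qed.

Variable s : K.
Hypothesis s0 : s != 0.
Hypothesis s_lt1 : `|s| < 1.
Local Notation q := (s ^+ 2).
Local Notation p := (q ^+ 2).
Local Notation w := (iqfact p).

Let q_lt1 : `|q| < 1. Proof. exact: norm_expr_lt1. Qed.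
Let p_lt1 : `|p| < 1. Proof. exact: norm_expr_lt1. Qed.
Let p0 : p != 0. Proof. by rewrite !expf_neq0. Qed.
Let q0 : q != 0. Proof. by rewrite !expf_neq0. Qed.
Let P0 : qpoch_inf p p != 0. Proof. exact: qfact_inf_neq0. Qed.

Let expr_neqN1 (x : K) n : `|x| < 1 -> - x * p ^+ n != 1.
Proof.
move=> x1; apply: contraTneq (_ : `|x * p ^+ n| < 1) => [xpn|].
  by rewrite -normrN -mulNr xpn normr1 ltxx.
by rewrite normrM (le_lt_trans _ x1) // ler_piMr // normrX exprn_ile1 // ltW.
Qed.

(** As (2 k)^2 = 8 tri k + 4 k, the exponent of q is (16 m + 28) tri k + (8 m + 8) k: a theta series
    with base [P] and argument [z]. *)
Lemma cvg_even_side (m : nat) :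
  even_side s m.+1 L @[L --> \oo] -->
  qpochs_inf [:: q ^+ (8 * m + 20); q ^+ (8 * m + 8); q ^+ (16 * m + 28)]
             (q ^+ (16 * m + 28)) / qpochs_inf [:: q; q ^+ 3; q ^+ 4] (q ^+ 4).
Proof.
have [D D0 wD] := iqfact_bounded geometric_cvg0 qpoch_is_cvg p_lt1.
set P := q ^+ (16 * m + 28); set z := q ^+ (8 * m + 8).
have z0 : z != 0 by rewrite expf_neq0.
have PE : P = q ^+ (8 * m + 20) * z by rewrite -exprD; congr (_ ^+ _); lia.
have PzE : P / z = q ^+ (8 * m + 20) by rewrite PE mulfK.
have Pz1 : `|P / z| < 1 by rewrite PzE addnS norm_expr_lt1.
have P1 : `|P| < 1 by rewrite /P addnS norm_expr_lt1.
have z1 : `|z| < 1 by rewrite /z addnS norm_expr_lt1.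
have PP0 : P != 0 by rewrite expf_neq0.
have bnd L (k : int) : `|w (L%:Z - k - k) * w (L%:Z + k + k)| <= D * D.
  by rewrite normrM ler_pM.
have lim (k : int) : w (L%:Z - k - k) * w (L%:Z + k + k) @[L --> \oo] -->
    (qpoch_inf p p)^-1 * (qpoch_inf p p)^-1.
  apply: cvgM.
    by under eq_fun do rewrite -addrA; apply: cvg_iqfact.
  by under eq_fun do rewrite -addrA; apply: cvg_iqfact.
have := cvg_theta geometric_cvg0 qpoch_is_cvg 0 PP0 z0 P1 z1 Pz1 bnd lim.
move=> th; have := cvgM (cvgM (@cvg_qpoch' p _ p_lt1) (@cvg_qpoch' (- q) _ p_lt1)) th.
(* For infinite products, (- q; p) / (p; p) = 1 / ((q; p) (p^2; p^2)), and (q; p) splits into (q;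
   q^4) (q^3; q^4). *)
have -> : qpoch_inf p p * qpoch_inf (- q) p * ((qpoch_inf p p)^-1 * (qpoch_inf p p)^-1 *
    (qpoch_inf z P * qpoch_inf (P / z) P * qpoch_inf P P)) =
    qpochs_inf [:: q ^+ (8 * m + 20); z; P] P / qpochs_inf [:: q; q ^+ 3; q ^+ 4] (q ^+ 4).
  rewrite /qpochs_inf !big_cons !big_nil PzE.
  have q4 : q ^+ 4 = p ^+ 2 by rewrite -[RHS]exprM.
  have q3 : q ^+ 3 = q * p by rewrite -exprS.
  have e1 := qpoch_inf_double q p_lt1; have e3 := qpoch_infN q p_lt1.
  have := qpoch_inf_double p p_lt1; rewrite -[p * p]expr2 => e2.
  have N0 : qpoch_inf (- q) p != 0.
    by apply: qpoch_inf_neq0 => // k; apply: expr_neqN1.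
  have := P0; rewrite q3 q4 e2 -e3 e1.
  rewrite !mulf_eq0 !negb_or => /andP[/andP[h1 /andP[h2 h3]] h4].
  by field; rewrite h1 h2 h3 h4.
have even_sideE L : even_side s m.+1 L = qpoch p p L * qpoch (- q) p L *
    bisum (fun k => P ^+ tri k * (- z) ^ k * (w (L%:Z - k - k) * w (L%:Z + k + k)))
      L.+1 (L + 0).
  rewrite /even_side addn0; congr (_ * _); apply: eq_bisum => k; congr (_ * _).
  rewrite -(mulN1r z) (expfzMl (-1) z) [RHS]mulrCA [LHS]mulrCA; congr (_ * _).
  rewrite /P /z !exprnP !exprz_exp.
  apply: (mulr_exprz_eq s0).
  by rewrite sqr_double_tri !PoszM !PoszD -[m.+1]addn1 PoszD; ring.
by move=> h; under eq_fun do rewrite even_sideE; exact: h.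
Qed.

(* Setting [u = - q], the base and argument of the theta series are [u ^ (4 m + 7)]
   and [u ^ (4 m + 4)], so that its signs alternate. *)
Lemma cvg_odd_side (m : nat) :
  odd_side s m.+1 L @[L --> \oo] -->
  s ^+ m.+3 / p *
  (qpochs_inf [:: - q ^+ 3; q ^+ (4 * m + 4); - q ^+ (4 * m + 7)]
             (- q ^+ (4 * m + 7)) / qpochs_inf [:: q ^+ 2; q ^+ 2; q ^+ 4] (q ^+ 4)).
Proof.
have [D D0 wD] := iqfact_bounded geometric_cvg0 qpoch_is_cvg p_lt1.
set P := - q ^+ (4 * m + 7); set z := q ^+ (4 * m + 4).
have z0 : z != 0 by rewrite expf_neq0.
have PE : P = - q ^+ 3 * z by rewrite mulNr -exprD; congr (- _ ^+ _); lia.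
have PzE : P / z = - q ^+ 3 by rewrite PE mulfK.
have Pz1 : `|P / z| < 1 by rewrite PzE normrN norm_expr_lt1.
have P1 : `|P| < 1 by rewrite /P normrN addnS norm_expr_lt1.
have z1 : `|z| < 1 by rewrite /z addnS norm_expr_lt1.
have PP0 : P != 0 by rewrite oppr_eq0 expf_neq0.
have bnd L (k : int) : `|w (L%:Z - k) * w (L%:Z + k + 1)| <= D * D.
  by rewrite normrM ler_pM.
have lim (k : int) : w (L%:Z - k) * w (L%:Z + k + 1) @[L --> \oo] -->
    (qpoch_inf p p)^-1 * (qpoch_inf p p)^-1.
  apply: cvgM; first exact: cvg_iqfact.
  by under eq_fun do rewrite -addrA; apply: cvg_iqfact.
have := cvg_theta geometric_cvg0 qpoch_is_cvg 1 PP0 z0 P1 z1 Pz1 bnd lim.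
move=> th; have := cvgMl_tmp (a := s ^+ m.+3 / p)
  (cvgM (cvgM (@cvg_qpoch' p _ p_lt1) (@cvg_qpoch' (- p) _ p_lt1)) th).
(* Here (- p; p) / (p; p) = (p^2; p^2) / (p; p)^2, and (p; p) = (p; p^2) (p^2; p^2). *)
have -> : qpoch_inf p p * qpoch_inf (- p) p * ((qpoch_inf p p)^-1 * (qpoch_inf p p)^-1 *
    (qpoch_inf z P * qpoch_inf (P / z) P * qpoch_inf P P)) =
    qpochs_inf [:: - q ^+ 3; z; P] P / qpochs_inf [:: p; p; q ^+ 4] (q ^+ 4).
  rewrite /qpochs_inf !big_cons !big_nil PzE.
  have q4 : q ^+ 4 = p ^+ 2 by rewrite -[RHS]exprM.
  have := qpoch_inf_double p p_lt1; rewrite -[p * p]expr2 => e2.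
  have e3 := qpoch_infN p p_lt1; have h := P0.
  have -> : qpoch_inf (- p) p = qpoch_inf (p ^+ 2) (p ^+ 2) / qpoch_inf p p.
    by rewrite -e3 mulfK.
  move: h; rewrite q4 e2 mulf_eq0 negb_or => /andP[h1 h2].
  by field; rewrite h1 h2.
have odd_sideE L : odd_side s m.+1 L = s ^+ m.+3 / p * (qpoch p p L * qpoch (- p) p L *
    bisum (fun k => P ^+ tri k * (- z) ^ k * (w (L%:Z - k) * w (L%:Z + k + 1)))
      L.+1 (L + 1)).
  rewrite /odd_side addn1 [RHS]mulrA; congr (_ * _); apply: eq_bisum => k; congr (_ * _).
  have -> : P = (- q) ^+ (4 * m + 7).
    by rewrite exprNn -signr_odd oddD oddM /= expr1 mulN1r.
  rewrite -(mulN1r z) (expfzMl (-1) z) [RHS]mulrCA [LHS]mulrCA; congr (_ * _).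
  have -> : z = (- q) ^+ (4 * m + 4).
    by rewrite exprNn -signr_odd oddD oddM /= expr0 mul1r.
  have u0 : - q != 0 by rewrite oppr_eq0.
  have -> : p = (- q) ^+ 2 by rewrite sqrrN.
  rewrite !exprnP !exprz_exp.
  apply: (mulr_exprz_eq u0).
  by rewrite sqr_tri !PoszM !PoszD -[m.+1]addn1 PoszD; ring.
by move=> h; under eq_fun do rewrite odd_sideE; exact: h.
Qed.

End Limits.

(** * Dominated convergence for the sum over column vectors *)

Definition boxes (k B : nat) : seq (seq nat) :=
  [seq n :: l | n <- iota 0 B, l <- [seq rcons v m | v <- words k B, m <- iota 0 B.*2]].

Lemma big_boxes (V : nmodType) (F : seq nat -> V) k B :
  \sum_(l <- boxes k B) F l =
  \sum_(0 <= n < B) \sum_(v <- words k B) \sum_(0 <= m < B.*2) F (n :: rcons v m).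
Proof.
rewrite /boxes big_allpairs_dep /index_iota !subn0; apply: eq_bigr => n _.
by rewrite big_allpairs_dep.
Qed.

Lemma boxes_uniq k B : uniq (boxes k B).
Proof.
apply: allpairs_uniq; [exact: iota_uniq| |by move=> [x l] [y l'] _ _ /= [-> ->]].
apply: allpairs_uniq; [exact: words_uniq|exact: iota_uniq|].
by move=> [v m] [v' m'] _ _ /= /rcons_inj[-> ->].
Qed.

Lemma mem_boxesP k B l : l \in boxes k B ->
  exists n v m, l = n :: rcons v m /\ size v = k.
Proof.
case/allpairsPdep => n [l' [_ /allpairsPdep[v [m [vk _ ->]]] ->]].
by exists n, v, m; split=> //; apply: size_words vk.
Qed.

Lemma size_kP k (l : seq nat) : size l = k.+2 ->
  exists n v m, l = n :: rcons v m /\ size v = k.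
Proof.
case: l => // n l; case/lastP: l => // v m [].
by rewrite size_rcons => -[sv]; exists n, v, m.
Qed.

Lemma leq_sumn_chain_exponent e v j : (sumn v <= chain_exponent e v j)%N.
Proof. by case: v => //= a v; nia. Qed.

Lemma leq_euler_exponent n M : (n <= 2 * (n * n + n * M))%N.
Proof. by nia. Qed.

Section ColumnSum.
Local Open Scope classical_set_scope.
Variables (K : numFieldType).
Hypothesis geometric_cvg0 :
  forall x : K, `|x| < 1 -> x ^+ n @[n --> \oo] --> (0 : K).
Hypothesis qpoch_is_cvg :
  forall a x : K, `|x| < 1 -> cvgn (fun n => qpoch a x n).
Variable s : K.
Hypothesis s0 : s != 0.
Hypothesis s_lt1 : `|s| < 1.
Local Notation q := (s ^+ 2).
Local Notation p := (q ^+ 2).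
Local Notation w := (iqfact p).

Let q_lt1 : `|q| < 1. Proof. exact: norm_expr_lt1. Qed.
Let p_lt1 : `|p| < 1. Proof. exact: norm_expr_lt1. Qed.
Let p0 : p != 0. Proof. by rewrite !expf_neq0. Qed.
Let P0 : qpoch_inf p p != 0. Proof. exact: qfact_inf_neq0. Qed.

Definition column_term (n : nat) (v : seq nat) (M : nat) : K :=
  q ^+ (n * n + n * M) * w n%:Z *
  (p ^+ chain_exponent (odd M) v M./2 * s ^+ (odd M * size v) *
   (\prod_(a <- v) w a%:Z)) *
  (s ^+ (M * M + 2 * M) / qpoch q q M).

(* [column_term] times [(p; p)_A / (p; p)_(A - n)] with [A = L - M / 2] and
   [(p; p)_L / (p; p)_(L - x)] with [x] the total of [v] and [M / 2]. *)
Definition column_term_trunc (L n : nat) (v : seq nat) (M : nat) : K :=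
  euler_term s (L - M./2) n M * chain_term s L v M *
  (s ^+ (M * M + 2 * M) / qpoch q q M).

(** Both summands come from one term [T], taken at M = m and M = m + 1. In the second, 1 - q^(m + 1)
    turns (q; q)_(m + 1) into (q; q)_m and 1 / p removes the excess power of q. *)
Definition on_seq (k : nat) (T : nat -> seq nat -> nat -> K) (l : seq nat) : K :=
  let n := head 0%N l in let v := take k (behead l) in let m := last 0%N l in
  T n v m + T n v m.+1 * ((1 - q ^+ m.+1) / p).

Lemma on_seqE k T n v m : size v = k ->
  on_seq k T (n :: rcons v m) =
  T n v m + T n v m.+1 * ((1 - q ^+ m.+1) / p).
Proof.
by move=> sv; rewrite /on_seq /= last_rcons -cats1 -sv take_size_cat.
Qed.

Lemma sum_column_term_trunc k L :
  \sum_(l <- boxes k L.+1) on_seq k (column_term_trunc L) l =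
  even_side s k.+1 L + odd_side s k.+1 L.
Proof.
rewrite big_boxes -finite_identity //; last exact: expr_neq1.
apply: eq_bigr => n _; rewrite !big_seq; apply: eq_bigr => v vk.
have sv := size_words vk.
under eq_bigr do rewrite (on_seqE _ _ _ sv).
rewrite big_split /=.
pose G M := column_term_trunc L n v M * ((1 - q ^+ M) / p).
(* Shifting m by one costs no boundary terms: 1 - q^M vanishes at M = 0, and the cutoff vanishes at
   M = 2 (L + 1). *)
have -> : \sum_(0 <= m < L.+1.*2) column_term_trunc L n v m.+1 * ((1 - q ^+ m.+1) / p) =
    \sum_(0 <= m < L.+1.*2) G m.
  have G0 : G 0%N = 0 by rewrite /G expr0 subrr mul0r mulr0.
  have GB : G L.+1.*2 = 0.
    rewrite /G /column_term_trunc /chain_term doubleK.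
    by rewrite (iqfact_neg _ (_ : L%:Z - _ < 0)) ?mulr0 ?mul0r //; lia.
  have : G 0%N + \sum_(0 <= m < L.+1.*2) G m.+1 =
      \sum_(0 <= m < L.+1.*2) G m + G L.+1.*2.
    by rewrite -big_nat_recl // -big_nat_recr.
  by rewrite GB addr0 G0 add0r.
rewrite -big_split /=; apply: eq_bigr => M _.
by rewrite /G /column_term_trunc /last_term; ring.
Qed.

(** Cutoffs and inverse factorials are bounded uniformly in L, and the exponents of s are at least
    n, the total of [v], and M respectively. *)
Lemma column_term_trunc_bound k : exists2 C : K, 0 < C &
  forall L n v M, size v = k ->
  `|column_term_trunc L n v M| <=
    C * (`|s| ^+ n * (\prod_(a <- v) `|s| ^+ a) * `|s| ^+ M).
Proof.
have [D D0 wD] := iqfact_bounded geometric_cvg0 qpoch_is_cvg p_lt1.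
have [D' D'0 wD'] := iqfact_bounded geometric_cvg0 qpoch_is_cvg q_lt1.
have [E E0 qE] := cvgn_bounded (@qpoch_is_cvg p p p_lt1).
exists (D * (E * D) * (D ^+ k * (E * D)) * D').
  by rewrite !mulr_gt0 ?exprn_gt0.
move=> L n v M sv.
have sle (i j : nat) : (i <= j)%N -> `|s| ^+ j <= `|s| ^+ i.
  by move=> ij; rewrite ler_wiXn2l // ltW.
have b1 : `|euler_term s (L - M./2) n M| <= `|s| ^+ n * (D * (E * D)).
  rewrite /euler_term !normrM -mulrA -exprM normrX.
  rewrite ler_pM ?mulr_ge0 // ?ler_pM ?mulr_ge0 //; apply: sle.
  exact: leq_euler_exponent.
have b2 : `|chain_term s L v M| <= (\prod_(a <- v) `|s| ^+ a) * (D ^+ k * (E * D)).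
  rewrite /chain_term !normrM [leRHS]mulrA.
  have bw : `|\prod_(a <- v) w a%:Z| <= D ^+ k.
    rewrite -sv; elim: (v) => [|a v' IHv]; first by rewrite big_nil normr1.
    by rewrite big_cons normrM /= (exprS D) ler_pM.
  have be : `|p ^+ chain_exponent (odd M) v M./2| * `|s ^+ (odd M * size v)| <=
     \prod_(a <- v) `|s| ^+ a.
    apply: (@le_trans _ _ (`|s| ^+ sumn v)).
      rewrite -!exprM !normrX -exprD; apply: sle.
      apply: leq_trans (leq_sumn_chain_exponent (odd M) v M./2) _.
      by rewrite mulnA (leq_trans _ (leq_addr _ _)) // leq_pmull.
    elim: (v) => [|b v1 IHv]; first by rewrite big_nil.
    by rewrite big_cons /= exprD ler_pM ?exprn_ge0.
  apply: ler_pM; rewrite ?mulr_ge0 //; last by apply: ler_pM.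
  by apply: ler_pM; rewrite ?mulr_ge0.
have b3 : `|s ^+ (M * M + 2 * M) / qpoch q q M| <= `|s| ^+ M * D'.
  rewrite normrM normrX -iqfactE; apply: ler_pM => //.
  by apply: sle; rewrite (leq_trans _ (leq_addl _ _)) // leq_pmull.
rewrite /column_term_trunc normrM (normrM (euler_term _ _ _ _)).
apply: (@le_trans _ _ (`|s| ^+ n * (D * (E * D)) *
   ((\prod_(a <- v) `|s| ^+ a) * (D ^+ k * (E * D))) * (`|s| ^+ M * D'))).
  by apply: ler_pM => //; apply: ler_pM.
by rewrite le_eqVlt; apply/orP; left; apply/eqP; ring.
Qed.

Lemma column_term_trunc_cvg n v M :
  column_term_trunc L n v M @[L --> \oo] --> column_term n v M.
Proof.
have u1 c : qpoch p p L * w (L%:Z - c%:Z) @[L --> \oo] --> (1 : K).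
  have := cvgM (@cvg_qpoch _ qpoch_is_cvg p p p_lt1)
    (cvg_iqfact geometric_cvg0 qpoch_is_cvg p_lt1 (- c%:Z)).
  by rewrite mulfV //; apply.
have u2 : qpoch p p (L - M./2) * w ((L - M./2)%N%:Z - n%:Z) @[L --> \oo] --> (1 : K).
  have := u1 n; rewrite -(cvg_centern M./2); apply.
have := cvgMr_tmp (b := s ^+ (M * M + 2 * M) / qpoch q q M)
  (cvgM (cvgMl_tmp (a := q ^+ (n * n + n * M) * w n%:Z) u2)
   (cvgMl_tmp (a := p ^+ chain_exponent (odd M) v M./2 * s ^+ (odd M * size v) *
   (\prod_(a <- v) w a%:Z)) (u1 (sumn v + M./2)%N))).
by rewrite !mulr1; apply.
Qed.

Lemma has_sum_columns k :
  has_sum (fun n : 'cV[nat]_k.+2 => on_seq k column_term (seq_of_col n))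
   (qpochs_inf [:: q ^+ (8 * k + 20); q ^+ (8 * k + 8); q ^+ (16 * k + 28)]
             (q ^+ (16 * k + 28)) / qpochs_inf [:: q; q ^+ 3; q ^+ 4] (q ^+ 4) +
    s ^+ k.+3 / p *
  (qpochs_inf [:: - q ^+ 3; q ^+ (4 * k + 4); - q ^+ (4 * k + 7)]
             (- q ^+ (4 * k + 7)) / qpochs_inf [:: q ^+ 2; q ^+ 2; q ^+ 4] (q ^+ 4))).
Proof.
have [C C0 HC] := column_term_trunc_bound k.
(* The second term of [on_seq] carries the factor (1 - q^(m + 1)) / p, of norm at most 2 / |p|. *)
pose C' := C * (1 + 2 / `|p|).
have C'0 : 0 <= C' by rewrite mulr_ge0 ?addr_ge0 ?divr_ge0 // ltW.
pose g (n : 'cV[nat]_k.+2) := C' * \prod_(a <- seq_of_col n) `|s| ^+ a.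
pose fL L (n : 'cV[nat]_k.+2) := on_seq k (column_term_trunc L) (seq_of_col n).
pose D L := [seq col_of_seq k.+2 l | l <- boxes k L.+1].
apply: (tannery_has_sum (g := g) (fL := fL) (D := D)).
- by move=> n; rewrite mulr_ge0 // prodr_ge0 // => a _; rewrite exprn_ge0.
- by apply: small_tailsZ => //; apply: geometric_tails_col.
- move=> L; rewrite map_inj_in_uniq ?boxes_uniq // => l l'.
  move=> /mem_boxesP[n [v [m [-> sv]]]] /mem_boxesP[n' [v' [m' [-> sv']]]].
  by apply: col_of_seq_inj; rewrite /= size_rcons ?sv ?sv'.
- move=> n; have := near_all_lt (seq_of_col n); apply: filterS => L.
  have [n1 [v [m [nE sv]]]] := size_kP (size_seq_of_col n).
  rewrite nE /= all_rcons => /and3P[nL mL vL].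
  apply/mapP; exists (seq_of_col n); last by rewrite seq_of_colK.
  rewrite nE; apply/allpairsPdep; exists n1, (rcons v m); split=> //.
    by rewrite mem_iota /= add0n ltnW.
  apply/allpairsPdep; exists v, m; split=> //.
    rewrite mem_words sv eqxx; apply: sub_all vL => a /=; exact: ltnW.
  by rewrite mem_iota /= add0n -addnn ltn_addr // ltnW.
- move=> L n; rewrite /fL /g.
  have [n1 [v [m [-> sv]]]] := size_kP (size_seq_of_col n).
  rewrite on_seqE // big_cons -cats1 big_cat big_seq1 /=.
  set S := `|s| ^+ n1 * _.
  have -> : C' * S = C * S + C * S * (2 / `|p|) by rewrite /C'; ring.
  apply: le_trans (ler_normD _ _) _; apply: lerD.
    by rewrite /S mulrA; apply: HC.
  rewrite normrM normf_div.
  have q2 : `|1 - q ^+ m.+1| <= 2.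
    apply: le_trans (ler_normB _ _) _; rewrite normr1 -[leRHS]/(1 + 1) lerD2l.
    by rewrite ltW // norm_expr_lt1.
  apply: ler_pM; rewrite ?divr_ge0 ?ler_wpM2r ?invr_ge0 //.
  apply: le_trans (HC _ _ _ _ sv) _; rewrite /S -mulrA ler_wpM2l ?(ltW C0) //.
  have Pv : 0 <= \prod_(a <- v) `|s| ^+ a.
    by apply: prodr_ge0 => a _; apply: exprn_ge0.
  rewrite ler_wpM2l ?exprn_ge0 // ler_wpM2l // exprS.
  by rewrite ler_piMl ?exprn_ge0 // ltW.
- move=> n; rewrite /fL.
  have [n1 [v [m [-> sv]]]] := size_kP (size_seq_of_col n).
  under eq_fun do rewrite on_seqE //.
  rewrite on_seqE //; apply: cvgD; first exact: column_term_trunc_cvg.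
  by apply: cvgMr_tmp; apply: column_term_trunc_cvg.
- have sE L : \sum_(n <- D L) fL L n = even_side s k.+1 L + odd_side s k.+1 L.
    rewrite -sum_column_term_trunc /D big_map !big_seq; apply: eq_bigr => l lB.
    rewrite /fL col_of_seqK //.
    by have [n [v [m [-> sv]]]] := mem_boxesP lB; rewrite /= size_rcons sv.
  under eq_fun do rewrite sE.
  exact: cvgD (@cvg_even_side _ geometric_cvg0 qpoch_is_cvg _ s0 s_lt1 k)
    (@cvg_odd_side _ geometric_cvg0 qpoch_is_cvg _ s0 s_lt1 k).
Qed.

End ColumnSum.

(** * The complex field and the nome *)

Section ComplexFacts.
Local Open Scope classical_set_scope.
Variable R : realType.
Implicit Types (z w : R[i]).
Let C : numFieldType := R[i].

(** The norm of [R[i]] takes values in [R[i]]; a real-valued copy gives access to real analysis. *)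
Definition cnorm z : R := Num.sqrt (complex.Re z ^+ 2 + complex.Im z ^+ 2).

Lemma cnormE z : `|z| = (cnorm z)%:C. Proof. exact: normc_def. Qed.

Lemma cnorm_ge0 z : 0 <= cnorm z. Proof. exact: sqrtr_ge0. Qed.

Lemma cnormM z w : cnorm (z * w) = cnorm z * cnorm w.
Proof. by apply: complexI; rewrite rmorphM /= -!cnormE normrM. Qed.

Lemma cnormX z n : cnorm (z ^+ n) = cnorm z ^+ n.
Proof. by apply: complexI; rewrite rmorphXn /= -!cnormE normrX. Qed.

Lemma cnormN z : cnorm (- z) = cnorm z.
Proof. by apply: complexI; rewrite -!cnormE normrN. Qed.

Lemma cnorm1 : cnorm 1 = 1.
Proof. by apply: complexI; rewrite -!cnormE normr1. Qed.

Lemma ler_cnormD z w : cnorm (z + w) <= cnorm z + cnorm w.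
Proof. by rewrite -lecR rmorphD /= -!cnormE ler_normD. Qed.

Lemma Re_le_cnorm z : `|complex.Re z| <= cnorm z.
Proof. by rewrite -sqrtr_sqr ler_wsqrtr // lerDl sqr_ge0. Qed.

Lemma Im_le_cnorm z : `|complex.Im z| <= cnorm z.
Proof. by rewrite -sqrtr_sqr ler_wsqrtr // lerDr sqr_ge0. Qed.

Lemma cnorm_le z : cnorm z <= `|complex.Re z| + `|complex.Im z|.
Proof.
rewrite -[leRHS]ger0_norm ?addr_ge0 // -sqrtr_sqr ler_wsqrtr // sqrrD.
by rewrite !real_normK ?num_real // addrAC lerDl mulrn_wge0 // mulr_ge0.
Qed.

Lemma ReB z w : complex.Re (z - w) = complex.Re z - complex.Re w.
Proof. by case: z w => [a b] [c d]. Qed.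

Lemma ImB z w : complex.Im (z - w) = complex.Im z - complex.Im w.
Proof. by case: z w => [a b] [c d]. Qed.

Lemma cvg_complex (u : nat -> C) (a b : R) :
    complex.Re (u n) @[n --> \oo] --> a -> complex.Im (u n) @[n --> \oo] --> b ->
  u n @[n --> \oo] --> (a +i* b : C).
Proof.
move=> ua ub; apply/cvgrPdist_lt => e.
(* A positive element of [R[i]] has zero imaginary part. *)
case: e => e e'; rewrite ltcE /= => /andP[/eqP -> e0].
have e2 : 0 < e / 2 by rewrite divr_gt0.
move/cvgrPdist_lt: ua => /(_ _ e2) ua; move/cvgrPdist_lt: ub => /(_ _ e2) ub.
near=> n; rewrite cnormE ltcR; apply: le_lt_trans (cnorm_le _) _.
rewrite ReB ImB /= [e]splitr ltrD //; first by near: n.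
by near: n.
Unshelve. all: by end_near. Qed.

(** The telescoping series converges absolutely by comparison with a geometric one. *)
Lemma is_cvg_geometric_increments (u : nat -> R) (D x : R) :
    0 <= x -> x < 1 -> (forall n, `|u n.+1 - u n| <= D * x ^+ n) ->
  cvgn u.
Proof.
move=> x0 x1 uC.
have -> : u = (fun n => u 0%N + series (telescope u) n).
  by apply/funext => n; rewrite -eq_sum_telescope.
apply: is_cvgD; first exact: is_cvg_cst.
apply: normed_cvg; apply: (@series_le_cvg _ _ (geometric D x)).
- by move=> n /=.
- by move=> n /=; apply: le_trans (uC n).
- by move=> n /=; apply: uC.
- by apply: is_cvg_geometric_series; rewrite ger0_norm.
Qed.

Lemma complex_geometric_cvg0 (z : C) : `|z| < 1 -> z ^+ n @[n --> \oo] --> (0 : C).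
Proof.
rewrite cnormE -[1]/(1%:C) ltcR => z1.
have c : cnorm z ^+ n @[n --> \oo] --> (0 : R).
  by apply: cvg_expr; rewrite ger0_norm // cnorm_ge0.
apply: cvg_complex; apply/cvgr0Pnorm_lt => e e0;
  move/cvgr0Pnorm_lt: c => /(_ e e0); apply: filterS => n;
  rewrite ger0_norm ?exprn_ge0 ?cnorm_ge0 // -cnormX; apply: le_lt_trans.
  exact: Re_le_cnorm.
exact: Im_le_cnorm.
Qed.

(** By 1 + x <= exp x the partial products are bounded, so their increments decay geometrically;
    real and imaginary parts then converge separately. *)
Lemma complex_qpoch_is_cvg (a z : C) : `|z| < 1 -> cvgn (fun n => qpoch a z n).
Proof.
rewrite cnormE -[1]/(1%:C) ltcR => z1; have z0 := cnorm_ge0 z.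
pose B := expR (cnorm a * (1 - cnorm z)^-1).
have bound n : cnorm (qpoch a z n) <= B.
  apply: (@le_trans _ _ (expR (\sum_(0 <= k < n) cnorm a * cnorm z ^+ k))).
    elim: n => [|n IHn]; first by rewrite qpoch0 cnorm1 big_nil expR0.
    rewrite qpochS cnormM big_nat_recr //= expRD ler_pM ?cnorm_ge0 //.
    apply: le_trans (ler_cnormD _ _) _; rewrite cnorm1 cnormN cnormM cnormX.
    exact: expR_ge1Dx.
  by rewrite ler_expR -mulr_sumr ler_wpM2l ?cnorm_ge0 // geometric_sum_le.
have inc n : cnorm (qpoch a z n.+1 - qpoch a z n) <= B * cnorm a * cnorm z ^+ n.
  have -> : qpoch a z n.+1 - qpoch a z n = - (qpoch a z n * (a * z ^+ n)).
    by rewrite qpochS; ring.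
  by rewrite cnormN !cnormM cnormX mulrA !ler_wpM2r ?exprn_ge0 ?cnorm_ge0.
have cRe : cvgn (fun n => complex.Re (qpoch a z n)).
  apply: (is_cvg_geometric_increments z0 z1) => n.
  by rewrite -ReB; apply: le_trans (Re_le_cnorm _) (inc n).
have cIm : cvgn (fun n => complex.Im (qpoch a z n)).
  apply: (is_cvg_geometric_increments z0 z1) => n.
  by rewrite -ImB; apply: le_trans (Im_le_cnorm _) (inc n).
by apply/cvg_ex; eexists; apply: cvg_complex; [exact: cRe|exact: cIm].
Qed.

Lemma cexpD z w : cexp (z + w) = cexp z * cexp w.
Proof.
case: z w => [a b] [c d]; rewrite /cexp /= expRD cosD sinD rmorphM /=.
rewrite mulrACA; congr (_ * _).
by apply/eqP; rewrite eq_complex /=; apply/andP; split; apply/eqP; ring.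
Qed.

Lemma cexp0 : cexp (0 : R[i]) = 1.
Proof. by rewrite /cexp /= expR0 cos0 sin0 mul1r. Qed.

Lemma cnorm_cexp z : cnorm (cexp z) = expR (complex.Re z).
Proof.
rewrite /cexp cnormM /cnorm /= expr0n /= addr0 sqrtr_sqr cos2Dsin2 sqrtr1 mulr1.
by rewrite ger0_norm // expR_ge0.
Qed.

Variable tau : R[i].

Lemma qpowD x y : qpow tau (x + y) = qpow tau x * qpow tau y.
Proof.
have e : 0 +i* (2 * pi * ratr (x + y)) =
    (0 +i* (2 * pi * ratr x)) + (0 +i* (2 * pi * ratr y)) :> R[i].
  by apply/eqP; rewrite eq_complex /= addr0 eqxx rmorphD mulrDr /=.
by rewrite /qpow e mulrDl cexpD.
Qed.

Lemma qpow0 : qpow tau 0 = 1.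
Proof. by rewrite /qpow rmorph0 mulr0 (_ : 0 +i* 0 = 0) // mul0r cexp0. Qed.

Lemma qpow_natM x n : qpow tau (n%:R * x) = qpow tau x ^+ n.
Proof.
elim: n => [|n IHn]; first by rewrite mul0r qpow0.
by rewrite -natr1 mulrDl mul1r qpowD IHn exprSr.
Qed.

Lemma qpow_neq0 x : qpow tau x != 0.
Proof.
apply/eqP => q0; have := qpowD x (- x).
by rewrite q0 mul0r subrr qpow0; apply/eqP; rewrite oner_eq0.
Qed.

Lemma norm_qpow_lt1 x : 0 < complex.Im tau -> 0 < x -> `|qpow tau x| < 1.
Proof.
move=> tau0 x0; rewrite cnormE -[1]/(1%:C) ltcR cnorm_cexp.
case: tau tau0 => a b /= b0; rewrite mul0r sub0r expR_lt1 oppr_lt0.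
have rx : 0 < ratr x :> R by rewrite ltr0q.
by rewrite mulr_gt0 // mulr_gt0 // mulr_gt0 // pi_gt0.
Qed.

End ComplexFacts.

(** * The exponents *)

Lemma sum_nth_sumn (v : seq nat) : (\sum_(0 <= i < size v) nth 0 v i)%N = sumn v.
Proof. by rewrite sumnE [RHS](big_nth 0%N). Qed.

(** The sum of the suffix sums of [v]: an entry at position i lies in i + 1 suffixes. *)
Definition linear_form (v : seq nat) : nat :=
  (\sum_(0 <= i < size v) i.+1 * nth 0 v i)%N.

(** The sum of the squared suffix sums: min(i, j) + 1 suffixes contain both entries. *)
Definition quadratic_form (v : seq nat) : nat :=
  (\sum_(0 <= i < size v) \sum_(0 <= j < size v)
     (minn i j).+1 * nth 0 v i * nth 0 v j)%N.

Lemma linear_form_cons a v : linear_form (a :: v) = (a + sumn v + linear_form v)%N.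
Proof.
rewrite /linear_form /= big_nat_recl //= mul1n -addnA -sum_nth_sumn -big_split /=.
by congr addn; apply: eq_bigr => i _; rewrite mulSn.
Qed.

Lemma quadratic_form_cons a v :
  quadratic_form (a :: v) = ((a + sumn v) ^ 2 + quadratic_form v)%N.
Proof.
have -> : (quadratic_form (a :: v) =
    \sum_(0 <= j < (size v).+1) (minn 0 j).+1 * a * nth 0 (a :: v) j +
    \sum_(0 <= i < size v) \sum_(0 <= j < (size v).+1)
      (minn i.+1 j).+1 * nth 0 v i * nth 0 (a :: v) j)%N.
  by rewrite /quadratic_form [size (a :: v)]/= big_nat_recl.
have -> : (\sum_(0 <= j < (size v).+1) (minn 0 j).+1 * a * nth 0 (a :: v) j =
    a * (a + sumn v))%N.
  under eq_bigr do rewrite min0n mul1n.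
  by rewrite -big_distrr (sum_nth_sumn (a :: v)).
have -> : (\sum_(0 <= i < size v) \sum_(0 <= j < (size v).+1)
      (minn i.+1 j).+1 * nth 0 v i * nth 0 (a :: v) j =
    sumn v * a + sumn v * sumn v + \sum_(0 <= i < size v) \sum_(0 <= j < size v)
     (minn i j).+1 * nth 0 v i * nth 0 v j)%N.
  rewrite -mulnDr -{1}sum_nth_sumn big_distrl -big_split /=.
  apply: eq_bigr => i _; rewrite big_nat_recl //= minn0 mul1n mulnDr -addnA.
  congr addn; rewrite -sum_nth_sumn big_distrr -big_split /=.
  by apply: eq_bigr => j _; rewrite minnSS; ring.
rewrite /quadratic_form; ring.
Qed.

Lemma chain_exponentE e v j :
  chain_exponent e v j =
  (quadratic_form v + (2 * j + e) * linear_form v + size v * (j * j + e * j))%N.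
Proof.
elim: v => [|a v IHv]; first by rewrite /quadratic_form /linear_form !big_nil muln0.
by rewrite /= IHv quadratic_form_cons linear_form_cons; ring.
Qed.

(** Both sides are the sum of (2 y + M)^2 over the suffix sums y of [v], which removes the
    distinction by parity. *)
Lemma chain_exponent_half v M :
  (4 * chain_exponent (odd M) v M./2 + odd M * size v =
   4 * quadratic_form v + 4 * M * linear_form v + size v * (M * M))%N.
Proof.
have ME : M = (odd M + M./2 * 2)%N by rewrite muln2 odd_double_half.
have ee : (odd M * odd M = odd M)%N by case: odd.
rewrite chain_exponentE; move: ME ee.
move: (M./2) (nat_of_bool (odd M)) => j e -> ee.
by rewrite -[in X in (_ + X)%N]ee; ring.
Qed.

Section Exponents.
Variables (k n1 m : nat) (v : seq nat).
Hypothesis sv : size v = k.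
Let N i := nth 0%N (n1 :: rcons v m) i.

Lemma big_nat_ends (V : nmodType) (F : nat -> V) :
  \sum_(0 <= i < k.+2) F i = F 0%N + \sum_(0 <= i < k) F i.+1 + F k.+1.
Proof. by rewrite big_nat_recl // big_nat_recr //= addrA. Qed.

Let N0 : N 0 = n1. Proof. by []. Qed.

Let NS i : (i < k)%N -> N i.+1 = nth 0%N v i.
Proof. by move=> ik; rewrite /N /= nth_rcons sv ik. Qed.

Let Nmax : N k.+1 = m.
Proof. by rewrite /N /= nth_rcons sv ltnn eqxx. Qed.

Let neq i : (i < k)%N -> (i.+2 == k.+2) = false.
Proof. by move=> ik; rewrite !eqSS ltn_eqF. Qed.

Let linE : (\sum_(0 <= i < k) i.+1 * N i.+1 = linear_form v)%N.
Proof. by rewrite /linear_form sv; apply: eq_big_nat => i ik; rewrite NS. Qed.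

Lemma AD_quadratic :
  (\sum_(0 <= i < k.+2) \sum_(0 <= j < k.+2) N i * AD_entry k.+2 i.+1 j.+1 * N j =
   2 * (n1 * n1) + 2 * (n1 * m) + k.+1 * (m * m) + 4 * quadratic_form v +
   4 * (m * linear_form v))%N.
Proof.
have row F : (\sum_(0 <= j < k.+2) F j = F 0 + \sum_(0 <= j < k) F j.+1 + F k.+1)%N.
  exact: big_nat_ends.
have first : (\sum_(0 <= j < k.+2) N 0 * AD_entry k.+2 1 j.+1 * N j =
    2 * (n1 * n1) + n1 * m)%N.
  rewrite row big1_seq => [|j]; last first.
    by rewrite mem_index_iota /= => jk; rewrite /AD_entry /= neq // muln0.
  rewrite N0 Nmax /AD_entry /= eqxx; ring.
have middle i : (i < k)%N ->
    (\sum_(0 <= j < k.+2) N i.+1 * AD_entry k.+2 i.+2 j.+1 * N j =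
     4 * (\sum_(0 <= j < k) (minn i j).+1 * nth 0 v i * nth 0 v j) +
     2 * m * (i.+1 * N i.+1))%N.
  move=> ik; rewrite row Nmax {1 3}/AD_entry /= neq // eqxx.
  rewrite muln0 mul0n add0n big_distrr; congr addn; last first.
    by rewrite subn1 /=; ring.
  apply: eq_big_nat => j /= jk; rewrite /AD_entry /= !neq // !NS //.
  by rewrite !minnSS subn1 /=; ring.
have last : (\sum_(0 <= j < k.+2) N k.+1 * AD_entry k.+2 k.+2 j.+1 * N j =
    n1 * m + 2 * m * linear_form v + k.+1 * (m * m))%N.
  rewrite row N0 Nmax -linE big_distrr {1 3}/AD_entry /= eqxx; congr (_ + _ + _)%N.
  - by ring.
  - apply: eq_big_nat => j /= jk; rewrite /AD_entry /= eqxx neq // subn1 /=; ring.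
  - by rewrite subn1 /=; ring.
rewrite row first last.
have -> : (\sum_(0 <= i < k) \sum_(0 <= j < k.+2)
     N i.+1 * AD_entry k.+2 i.+2 j.+1 * N j =
   4 * quadratic_form v + 2 * m * linear_form v)%N.
  rewrite -linE /quadratic_form sv !big_distrr -big_split /=.
  by apply: eq_big_nat => i ik; rewrite middle.
by ring.
Qed.

Lemma bvec_linear :
  (\sum_(0 <= i < k.+2) N i * (i.+1 == k.+2) = m)%N.
Proof.
rewrite big_nat_ends big1_seq => [|j]; last first.
  by rewrite mem_index_iota /= => jk; rewrite neq // muln0.
by rewrite /= eqxx muln1 muln0 Nmax.
Qed.

Lemma btilde_linear :
  (\sum_(0 <= i < k.+2) N i * btilde_entry k.+2 i.+1 =
   n1 + 2 * linear_form v + k.+2 * m)%N.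
Proof.
rewrite big_nat_ends Nmax -linE big_distrr; congr (_ + _ + _)%N.
- by rewrite muln1.
- apply: eq_big_nat => j /= jk; rewrite /btilde_entry /= neq // subn1 /=; ring.
- by rewrite /btilde_entry /= eqxx mulnC.
Qed.

End Exponents.

(** Since all entries are natural numbers, the exponent is half a natural number and its power of q
    is a natural power of s. *)
Lemma nahm_exponentE k (B : nat -> nat) (b : 'cV[rat]_k.+2) (n : 'cV[nat]_k.+2) :
    (forall i, b i 0 = (B i)%:R) ->
  nahm_exponent (AD k.+2) b n =
  ((\sum_(0 <= i < k.+2) \sum_(0 <= j < k.+2)
      nth 0 (seq_of_col n) i * AD_entry k.+2 i.+1 j.+1 * nth 0 (seq_of_col n) j +
    2 * \sum_(0 <= i < k.+2) nth 0 (seq_of_col n) i * B i)%N)%:R * 2^-1.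
Proof.
move=> bB.
have nE (i : 'I_k.+2) : n i 0 = nth 0%N (seq_of_col n) i.
  by rewrite -[n in LHS]seq_of_colK mxE.
rewrite /nahm_exponent natrD mulrDl mulrC natrM [2%:R * _]mulrC mulfK //.
congr (_ * _ + _); rewrite big_mkord natr_sum !mxE; last first.
  by apply: eq_bigr => i _; rewrite !mxE bB nE natrM.
transitivity (\sum_j \sum_i (vecQ n)^T 0 i * AD k.+2 i j * vecQ n j 0).
  by apply: eq_bigr => j _; rewrite mxE mulr_suml.
rewrite exchange_big; apply: eq_bigr => i _ /=.
rewrite big_mkord natr_sum; apply: eq_bigr => j _.
by rewrite !mxE !nE !natrM.
Qed.

Lemma AD_denominatorE (K : numFieldType) (q : K) k (n : 'cV[nat]_k.+2) n1 v m :
    size v = k -> seq_of_col n = n1 :: rcons v m ->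
  AD_denominator q n =
  qpoch (q ^+ 2) (q ^+ 2) n1 * (\prod_(a <- v) qpoch (q ^+ 2) (q ^+ 2) a) * qpoch q q m.
Proof.
move=> sv nv.
have nE (i : 'I_k.+2) : n i 0 = nth 0%N (n1 :: rcons v m) i.
  by rewrite -nv -[n in LHS]seq_of_colK mxE.
pose F i := if i.+1 == k.+2 then qpoch q q (nth 0%N (n1 :: rcons v m) i)
            else qpoch (q ^+ 2) (q ^+ 2) (nth 0%N (n1 :: rcons v m) i).
rewrite /AD_denominator (eq_bigr (fun i : 'I_k.+2 => F i)) => [|i _]; last by rewrite nE.
rewrite -(big_mkord xpredT F) big_nat_recl // big_nat_recr //= mulrA /F /= eqxx.
rewrite nth_rcons sv ltnn eqxx; congr (_ * _ * _).
rewrite [RHS](big_nth 0%N) sv; apply: eq_big_nat => i /= ik.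
by rewrite nth_rcons sv ik !eqSS ltn_eqF.
Qed.

Lemma column_termE (K : numFieldType) (s : K) n v M :
  column_term s n v M =
  s ^+ (2 * (n * n) + 2 * (n * M) + (size v).+1 * (M * M) + 4 * quadratic_form v +
        4 * (M * linear_form v) + 2 * M) /
  (qpoch (s ^+ 2 ^+ 2) (s ^+ 2 ^+ 2) n *
   (\prod_(a <- v) qpoch (s ^+ 2 ^+ 2) (s ^+ 2 ^+ 2) a) *
   qpoch (s ^+ 2) (s ^+ 2) M).
Proof.
rewrite /column_term; set p := s ^+ 2 ^+ 2.
have -> : \prod_(a <- v) iqfact p a%:Z = (\prod_(a <- v) qpoch p p a)^-1.
  by rewrite prodfV.
have -> : (2 * (n * n) + 2 * (n * M) + (size v).+1 * (M * M) + 4 * quadratic_form v +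
    4 * (M * linear_form v) + 2 * M =
    2 * (n * n + n * M) + (4 * chain_exponent (odd M) v M./2 + odd M * size v) +
    (M * M + 2 * M))%N.
  by rewrite chain_exponent_half; ring.
have -> (a b c d : nat) : s ^+ (2 * a + (4 * b + c) + d) =
    s ^+ 2 ^+ a * p ^+ b * s ^+ c * s ^+ d.
  by rewrite /p -!exprM -!exprD; congr (_ ^+ _); ring.
by rewrite iqfactE !invfM; ring.
Qed.

(** * Specialization of s to the square root of the nome *)

Theorem theorem1p10 (R : realType) (tau : R[i]) (htau : 0 < complex.Im tau)
    (r : nat) (hr : (3 <= r)%N) :
  let q := qpow tau 1 in
  has_sum
    (fun n : 'cV[nat]_r =>
       (qpow tau (nahm_exponent (AD r) (bvec r) n) +
        qpow tau (nahm_exponent (AD r) (btilde r) n + (r%:R - 3) / 2))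
       / AD_denominator q n)
    (qpochs_inf [:: q ^+ (8 * r + 4); q ^+ (8 * r - 8); q ^+ (16 * r - 4)]
                (q ^+ (16 * r - 4))
     / qpochs_inf [:: q; q ^+ 3; q ^+ 4] (q ^+ 4)
     + qpow tau ((r%:R - 3) / 2) *
       (qpochs_inf [:: - q ^+ 3; q ^+ (4 * r - 4); - q ^+ (4 * r - 1)]
                   (- q ^+ (4 * r - 1))
        / qpochs_inf [:: q ^+ 2; q ^+ 2; q ^+ 4] (q ^+ 4))).
Proof.
(* There are k = r - 2 middle entries; r >= 3 makes r - 3 = k' natural, so q^((r - 3) / 2) =
   s^k'. *)
move=> q; case: r hr => [|[|[|k']]] // _; set k := k'.+1.
have -> : (8 * k.+2 + 4 = 8 * k + 20)%N by lia.
have -> : (8 * k.+2 - 8 = 8 * k + 8)%N by lia.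
have -> : (16 * k.+2 - 4 = 16 * k + 28)%N by lia.
have -> : (4 * k.+2 - 4 = 4 * k + 4)%N by lia.
have -> : (4 * k.+2 - 1 = 4 * k + 7)%N by lia.
pose s := qpow tau 2^-1.
have qpow_half n : qpow tau (n%:R * 2^-1) = s ^+ n by rewrite qpow_natM.
have qE : q = s ^+ 2 by rewrite -qpow_half mulfV.
have s0 : s != 0 by apply: qpow_neq0.
have s1 : `|s| < 1 by apply: norm_qpow_lt1; rewrite // invr_gt0.
have q1 n : q ^+ n.+1 != 1.
  by rewrite qE; apply: expr_neq1; apply: norm_expr_lt1.
have shift : qpow tau ((k.+2%:R - 3) / 2) = s ^+ k'.
  have -> : k.+2 = (k' + 3)%N by rewrite addn3.
  by rewrite natrD addrK qpow_half.
have := has_sum_columns (@complex_geometric_cvg0 R) (@complex_qpoch_is_cvg R) s0 s1 (k := k).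
rewrite -qE; have -> : s ^+ k.+3 / q ^+ 2 = qpow tau ((k.+2%:R - 3) / 2).
  rewrite shift qE -exprM; have -> : k.+3 = (k' + 4)%N by rewrite addn4.
  by rewrite exprD mulfK // expf_neq0.
congr has_sum; apply/funext => n.
have [n1 [v [m [nE sv]]]] := size_kP (size_seq_of_col n).
rewrite (AD_denominatorE q sv nE) nE on_seqE // -qE.
rewrite qpowD shift.
rewrite (@nahm_exponentE _ (fun i => i.+1 == k.+2)); last by move=> i; rewrite mxE.
rewrite (@nahm_exponentE _ (btilde_entry k.+2 \o S)); last by move=> i; rewrite mxE.
rewrite nE AD_quadratic // bvec_linear // btilde_linear // !qpow_half.
rewrite !column_termE sv -qE qpochS -exprS.
(* Passing from m to m + 1 gives the exponent of the second summand plus k + 3 = k' + 4, that is,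
   the shift s^k' and the factor q^2 cancelled by 1 / p. *)
have -> : s ^+ (2 * (n1 * n1) + 2 * (n1 * m.+1) + k.+1 * (m.+1 * m.+1) +
     4 * quadratic_form v + 4 * (m.+1 * linear_form v) + 2 * m.+1) =
    s ^+ (2 * (n1 * n1) + 2 * (n1 * m) + k.+1 * (m * m) + 4 * quadratic_form v +
     4 * (m * linear_form v) + 2 * (n1 + 2 * linear_form v + k.+2 * m)) * s ^+ k' * q ^+ 2.
  by rewrite qE -exprM -!exprD; congr (_ ^+ _); rewrite /k; ring.
have d1 : 1 - q ^+ m.+1 != 0 by rewrite subr_eq0 eq_sym q1.
have q0 : q != 0 by rewrite qE expf_neq0.
have qm0 := qfact_neq0 q1 m.
have q21 i : (q ^+ 2) ^+ i.+1 != 1 by rewrite -exprM mulnS; apply: q1.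
have qn0 := qfact_neq0 q21 n1.
have qv0 : \prod_(a <- v) qpoch (q ^+ 2) (q ^+ 2) a != 0.
  by rewrite prodf_seq_neq0; apply/allP => a _; apply: qfact_neq0.
move: (s ^+ _) (s ^+ _) => X Y; field.
by rewrite d1 q0 qm0 qn0 qv0.
Qed.
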